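(* Let $(\mathcal{E},\mathcal{D}(\mathcal{E}))$ be a symmetric, regular, strongly local Dirichlet form on $L^2(X,m)$ admitting a carré du champ operator $\Gamma$, assume that it is coercive (there is a constant $k$ with $\|u\|_2^2\le k\,\mathcal{E}(u,u)$ for all $u\in\mathcal{D}(\mathcal{E})$), and let $p>2$. Then the set function $E\mapsto\mathsf{cap}_p(E)$, $E\subset X$, has the following properties. 1) $\mathsf{cap}_p$ is strongly subadditive on compact sets: if $K,L$ are compact subsets of $X$ then $\mathsf{cap}_p(K\cup L)+\mathsf{cap}_p(K\cap L)\le\mathsf{cap}_p(K)+\mathsf{cap}_p(L)$. 2) $\mathsf{cap}_p$ is a Choquet capacity on $X$, that is: (2a) if $E_1\subset E_2$ then $\mathsf{cap}_p(E_1)\le\mathsf{cap}_p(E_2)$; (2b) if $(K_i)_i$ is a decreasing sequence of compact subsets of $X$ with $K=\bigcap_iK_i$, then $\mathsf{cap}_p(K)=\lim_i\mathsf{cap}_p(K_i)$; (2c) if $(E_i)_i$ is an increasing sequence of subsets of $X$ with $E=\bigcup_iE_i$, then $\mathsf{cap}_p(E)=\lim_i\mathsf{cap}_p(E_i)$. 3) If $(E_i)_i$ is a sequence of subsets of $X$ and $E=\bigcup_iE_i$, then $\mathsf{cap}_p(E)\le\sum_i\mathsf{cap}_p(E_i)$. 4) If $E\subset X$ and $\mathsf{cap}_p(E)=0$, then $E$ is $m$-negligible.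
   Context: Setting. $X$ is a locally compact separable metric space, $m$ is a finite positive Radon measure on $X$ with full support. A Dirichlet form $(\mathcal{E},\mathcal{D}(\mathcal{E}))$ on $L^2(X,m)$ is strongly local if $\mathcal{E}(u,v)=0$ whenever $u,v\in\mathcal{D}(\mathcal{E})$ have compact support and $v$ is constant on a neighbourhood of $\operatorname{supp}u$. It admits a carré du champ operator if there is a positive symmetric bilinear map $\Gamma:\mathcal{D}(\mathcal{E})\times\mathcal{D}(\mathcal{E})\to L^1(X,m)$ with $\mathcal{E}(uf,v)+\mathcal{E}(vf,u)-\mathcal{E}(uv,f)=\int_X f\,\Gamma(u,v)\,dm$ for all $u,v,f\in\mathcal{D}(\mathcal{E})\cap L^\infty(X,m)$; in the strongly local case $\mathcal{E}(u,v)=\frac12\int_X\Gamma(u,v)\,dm$ for all $u,v\in\mathcal{D}(\mathcal{E})$. Write $\Gamma(u):=\Gamma(u,u)$ and $\mathcal{D}_p:=\{u\in\mathcal{D}(\mathcal{E})\cap L^p(X,m):\Gamma(u)^{1/2}\in L^p(X,m)\}$. Capacity. For compact $K\subset X$ let $W(K):=\{w\in\mathcal{D}_p\cap C(X):w\ge1\text{ on }K\}$, where $C(X)$ is the set of continuous real functions on $X$, and set $\mathsf{cap}_p^o(K):=\inf\{\int_X\Gamma(u)^{p/2}\,dm:u\in W(K)\}$ if $W(K)\ne\emptyset$, and $\mathsf{cap}_p^o(K):=\infty$ if $W(K)=\emptyset$. For open $U\subset X$ set $\mathsf{cap}_p(U):=\sup\{\mathsf{cap}_p^o(K):K\subset U\text{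 compact}\}$. For arbitrary $E\subset X$ set $\mathsf{cap}_p(E):=\inf\{\mathsf{cap}_p(U):U\text{ open},\,E\subset U\}$ (in particular this defines $\mathsf{cap}_p(K)$ for compact $K$). *)

(* Defs.v *)
From HB Require Import structures.
From mathcomp Require Import all_boot all_order all_algebra.
From mathcomp Require Import all_classical all_reals all_analysis.

Set Implicit Arguments.
Unset Strict Implicit.
Unset Printing Implicit Defensive.

Import Order.TTheory GRing.Theory Num.Theory.
Import numFieldTopology.Exports.

Local Open Scope classical_set_scope.
Local Open Scope ring_scope.

HB.mixin Record isBorel d (K : numDomainType) T
    of Measurable d T & Metric K T := {
  borel_measurableE : @measurable d T = <<s @open T >>
}.

(* Measurable types are pointed, hence these spaces are nonempty. *)
#[short(type="borelMetricType")]
HB.structure Definition BorelMetric d (K : numDomainType) :=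
  {T of Measurable d T & Metric K T & isBorel d K T}.

Definition separable (T : topologicalType) : Prop :=
  exists2 S : set T, countable S & dense S.

Section measures.
Context {d : measure_display} {R : realType} {X : borelMetricType d R}.
Implicit Types (m : {finite_measure set X -> \bar R}) (u : X -> R).

(* A finite measure is trivially finite on compact sets, so only inner
   regularity has to be required. *)
Definition radon m : Prop := forall A : set X, measurable A ->
  m A = ereal_sup [set m K | K in [set K | compact K /\ K `<=` A]].

Definition measure_support m : set X :=
  [set x | forall U : set X, open U -> U x -> (0 < m U)%E].

Definition full_support m : Prop := measure_support m = [set: X].

(* The support of the measure |u| dm; unlike the closure of [u != 0] it depends
   only on the a.e. class of u. *)
Definition essential_support m u : set X :=
  [set x | forall U : set X, open U -> U x ->
     ~ \forall y \ae m, U y -> u y = 0].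

(* Continuous functions with compact support. *)
Definition Cc : set (X -> R) :=
  [set u | continuous u /\ compact (closure [set x | u x != 0])].

End measures.

(* Elements of L^p(X, m) are represented by functions X -> R. A domain D is thus
   a set of functions that is closed under a.e. modification, and E is only
   meaningful on D, where it has to be compatible with a.e. equality. *)
Section forms.
Context {d : measure_display} {R : realType} {X : borelMetricType d R}.
Variables (m : {finite_measure set X -> \bar R}).
Variables (D : set (X -> R)) (E : (X -> R) -> (X -> R) -> R).

Definition form1 (u v : X -> R) : R := E u v + (\int[m]_x (u x * v x))%R.

Record dirichlet_form : Prop := {
  df_L2 : forall (u : X -> R), D u -> u \in Lfun m 2%:E ;
  df_dom_ae : forall (u v : X -> R), D u -> measurable_fun [set: X] v ->
    u = v %[ae m] -> D v ;
  df_dom0 : D (cst 0) ;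
  df_dom_lin : forall (a : R) (u v : X -> R), D u -> D v -> D (a \*o u \+ v) ;
  df_dense : forall (f : X -> R) (e : R), f \in Lfun m 2%:E -> 0 < e ->
    exists2 u, D u & ('N[m]_2%:E [EFin \o (f \- u)%R] < e%:E)%E ;
  df_form_ae : forall (u v w : X -> R), D u -> D v -> D w -> u = v %[ae m] ->
    E u w = E v w ;
  df_form_lin : forall (a : R) (u v w : X -> R), D u -> D v -> D w ->
    E (a \*o u \+ v) w = a * E u w + E v w ;
  df_form_sym : forall (u v : X -> R), D u -> D v -> E u v = E v u ;
  df_form_ge0 : forall (u : X -> R), D u -> 0 <= E u u ;
  df_closed : forall u_ : nat -> X -> R, (forall n, D (u_ n)) ->
    (forall e : R, 0 < e -> exists N : nat, forall i j : nat,
       (N <= i)%N -> (N <= j)%N ->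
       form1 (u_ i \- u_ j) (u_ i \- u_ j) < e) ->
    exists2 u, D u &
      form1 (u_ n \- u) (u_ n \- u) @[n --> \oo] --> (0 : R) ;
  df_markov : forall (u : X -> R), D u ->
    let v := fun x => Num.min (Num.max (u x) 0) 1 in
    D v /\ E v v <= E u u
}.

Record regular_form : Prop := {
  rf_dense_dom : forall (u : X -> R) (e : R), D u -> 0 < e ->
    exists2 w, (D `&` Cc) w & form1 (u \- w) (u \- w) < e ;
  rf_dense_Cc : forall (f : X -> R) (e : R), Cc f -> 0 < e ->
    exists2 w, (D `&` Cc) w & forall x, `|f x - w x| < e
}.

Definition strongly_local : Prop := forall (u v : X -> R), D u -> D v ->
  compact (essential_support m u) -> compact (essential_support m v) ->
  (exists (U : set X) (c : R), [/\ open U, essential_support m u `<=` U &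
     \forall x \ae m, U x -> v x = c]) ->
  E u v = 0.

Definition coercive : Prop := exists k : R, forall (u : X -> R), D u ->
  (\int[m]_x (u x ^+ 2))%R <= k * E u u.

Variable G : (X -> R) -> (X -> R) -> X -> R.

(* The product formula determines G on bounded functions only: a positive
   symmetric bilinear map could be altered arbitrarily on an algebraic
   complement of the bounded functions. The energy identity fixes G on all
   of D. *)
Record carre_du_champ : Prop := {
  cdc_L1 : forall (u v : X -> R), D u -> D v -> G u v \in Lfun m 1%:E ;
  cdc_ae : forall (u v w : X -> R), D u -> D v -> D w -> u = v %[ae m] ->
    G u w = G v w %[ae m] ;
  cdc_lin : forall (a : R) (u v w : X -> R), D u -> D v -> D w ->
    G (a \*o u \+ v) w = (a \*o G u w \+ G v w) %[ae m] ;
  cdc_sym : forall (u v : X -> R), D u -> D v -> G u v = G v u %[ae m] ;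
  cdc_ge0 : forall (u : X -> R), D u -> \forall x \ae m, 0 <= G u u x ;
  cdc_product : forall (u v f : X -> R), D u -> D v -> D f ->
    u \in Lfun m +oo%E -> v \in Lfun m +oo%E -> f \in Lfun m +oo%E ->
    E (u \* f) v + E (v \* f) u - E (u \* v) f =
      (\int[m]_x (f x * G u v x))%R ;
  cdc_energy : strongly_local -> forall (u v : X -> R), D u -> D v ->
    E u v = 2^-1 * (\int[m]_x G u v x)%R
}.

End forms.

(* Num.sqrt and powR have junk values on negative reals; G u u is nonnegative
   almost everywhere. *)
Section capacity.
Context {d : measure_display} {R : realType} {X : borelMetricType d R}.
Variables (m : {finite_measure set X -> \bar R}).
Variables (D : set (X -> R)) (G : (X -> R) -> (X -> R) -> X -> R) (p : R).

Definition dom_p : set (X -> R) :=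
  [set u | [/\ D u, u \in Lfun m p%:E &
    (fun x => Num.sqrt (G u u x)) \in Lfun m p%:E]].

Definition test_functions (K : set X) : set (X -> R) :=
  [set w | [/\ dom_p w, continuous w & forall x, K x -> 1 <= w x]].

(* ereal_inf set0 = +oo *)
Definition cap_compact (K : set X) : \bar R :=
  ereal_inf [set (\int[m]_x (G u u x `^ (p / 2))%:E)%E
            | u in test_functions K].

Definition cap_open (U : set X) : \bar R :=
  ereal_sup [set cap_compact K | K in [set K | compact K /\ K `<=` U]].

Definition cap (A : set X) : \bar R :=
  ereal_inf [set cap_open U | U in [set U | open U /\ A `<=` U]].

End capacity.

Section choquet.
Context {R : realType} {T : topologicalType}.
Variable c : set T -> \bar R.

Definition strongly_subadditive_on_compacts : Prop := forall K L : set T,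
  compact K -> compact L -> (c (K `|` L) + c (K `&` L) <= c K + c L)%E.

Record choquet_capacity : Prop := {
  choquet_le : forall A B : set T, A `<=` B -> (c A <= c B)%E ;
  choquet_decr : forall K_ : nat -> set T, (forall i, compact (K_ i)) ->
    (forall i, K_ i.+1 `<=` K_ i) ->
    c (K_ i) @[i --> \oo] --> c (\bigcap_i K_ i) ;
  choquet_incr : forall A_ : nat -> set T,
    (forall i, A_ i `<=` A_ i.+1) ->
    c (A_ i) @[i --> \oo] --> c (\bigcup_i A_ i)
}.

End choquet.

(* Main.v *)
Require Import Defs.
From HB Require Import structures.
From mathcomp Require Import all_boot all_order all_algebra.
From mathcomp Require Import all_classical all_reals all_analysis.
From mathcomp Require Import measurable_realfun ess_sup_inf ring lra.

Set Implicit Arguments.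
Unset Strict Implicit.
Unset Printing Implicit Defensive.

Import Order.TTheory GRing.Theory Num.Theory.
Import numFieldTopology.Exports.

Local Open Scope classical_set_scope.
Local Open Scope ring_scope.

(* The set function cap is the outer capacity generated by cap_compact, and for
   outer capacities all the properties but the last one follow, by topology
   alone, from strong subadditivity on compact sets. The latter comes from
   truncation: Gamma(max u v) and Gamma(min u v) are Gamma(u) and Gamma(v) in
   some order almost everywhere, because Gamma(w^+) = 0 a.e. on [w <= 0] for a
   continuous w in the domain. This locality is obtained from the product formula
   tested on bumps supported in an open set where a bounded function of the domain
   vanishes, and extended by approximation in energy; the closedness of the form
   enters only through a Mazur-type lemma, which also shows that the domain
   contains positive parts and squares, as limits of combinations of unit
   contractions. By coercivity m(K) <= int w^2 <= k/2 int Gamma(w) for a test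
   function w of K, which gives the last property because
   t <= e + e^(1 - p/2) t^(p/2). *)

(** * Outer capacities *)

Section ereal_complements.
Context {R : realType}.
Implicit Types (A B : set \bar R) (z : \bar R).

(** For finite [z], nonnegativity makes the elements of [B] and the supremum of [A] finite, so that
    they can be moved across the inequality by subtraction. *)
Lemma ereal_supD_le A B z : A !=set0 -> B !=set0 ->
  (forall a, A a -> (0 <= a)%E) -> (forall b, B b -> (0 <= b)%E) ->
  (forall a b, A a -> B b -> (a + b <= z)%E) ->
  (ereal_sup A + ereal_sup B <= z)%E.
Proof.
move=> [a0 Aa0] [b0 Bb0] A0 B0 ABz.
have [->|zoo] := eqVneq z +oo%E; first exact: leey.
have z0 : (0 <= z)%E.
  by apply: (le_trans _ (ABz _ _ Aa0 Bb0)); apply: adde_ge0; [exact: A0|exact: B0].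
have zlt : (z < +oo)%E by rewrite ltey.
have fz : z \is a fin_num by rewrite ge0_fin_numE// lt_neqAle zoo leey.
have fB b : B b -> b \is a fin_num.
  move=> Bb; rewrite ge0_fin_numE ?B0//; apply: le_lt_trans zlt.
  by rewrite (le_trans _ (ABz _ _ Aa0 Bb))// leeDr// A0.
have fA : ereal_sup A \is a fin_num.
  rewrite ge0_fin_numE; last by rewrite (le_trans (A0 _ Aa0))// ereal_sup_ubound.
  apply: le_lt_trans zlt; apply: ge_ereal_sup => a Aa.
  by rewrite (le_trans _ (ABz _ _ Aa Bb0))// leeDl// B0.
rewrite -leeBrDl//; apply: ge_ereal_sup => b Bb.
rewrite leeBrDl// -leeBrDr ?fB//; apply: ge_ereal_sup => a Aa.
by rewrite leeBrDr ?fB// ABz.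
Qed.

Lemma le_ereal_infD A B z :
  (forall a, A a -> (0 <= a)%E) -> (forall b, B b -> (0 <= b)%E) ->
  (forall a b, A a -> B b -> (z <= a + b)%E) ->
  (z <= ereal_inf A + ereal_inf B)%E.
Proof.
move=> A0 B0 ABz.
have iA : (0 <= ereal_inf A)%E by apply: le_ereal_inf_tmp.
have iB : (0 <= ereal_inf B)%E by apply: le_ereal_inf_tmp.
have [->|Aoo] := eqVneq (ereal_inf A) +oo%E.
  by rewrite addye ?leey// gt_eqF// (lt_le_trans _ iB).
have [->|Boo] := eqVneq (ereal_inf B) +oo%E.
  by rewrite addey ?leey// gt_eqF// (lt_le_trans _ iA).
have fA : ereal_inf A \is a fin_num by rewrite ge0_fin_numE// lt_neqAle Aoo leey.
have fB : ereal_inf B \is a fin_num by rewrite ge0_fin_numE// lt_neqAle Boo leey.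
apply/lee_addgt0Pr => e e0; have e20 : 0 < e / 2 by rewrite divr_gt0.
have [a Aa ae] := lb_ereal_inf_adherent e20 fA.
have [b Bb be] := lb_ereal_inf_adherent e20 fB.
rewrite (le_trans (ABz _ _ Aa Bb))// (le_trans (leeD (ltW ae) (ltW be)))//.
by rewrite addeACA -EFinD -splitr.
Qed.

End ereal_complements.

Section outer_capacity.
Context {R : realType} {T : topologicalType}.
Variable c : set T -> \bar R.
Hypotheses (hausdorffT : hausdorff_space T) (normalT : normal_space T).
Hypothesis c_ge0 : forall K, (0 <= c K)%E.
Hypothesis le_c : forall K L, K `<=` L -> (c K <= c L)%E.
Hypothesis c_subadd : strongly_subadditive_on_compacts c.

(** For [c := cap_compact m D G p], [inner_cap] and [outer_cap] are convertible to [cap_open] and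
    [cap]. *)
Definition inner_cap (U : set T) : \bar R :=
  ereal_sup [set c K | K in [set K | compact K /\ K `<=` U]].

Definition outer_cap (A : set T) : \bar R :=
  ereal_inf [set inner_cap U | U in [set U | open U /\ A `<=` U]].

(** By normality the closed set K \ V, which lies in U, has an open neighbourhood [W'] whose closure
    stays in U. Cutting K along [W'] gives the two pieces. *)
Lemma compact_splitU (K U V : set T) : compact K -> open U -> open V ->
  K `<=` U `|` V -> exists K1 K2, [/\ compact K1, compact K2, K1 `<=` U,
    K2 `<=` V & K `<=` K1 `|` K2].
Proof.
move=> cK oU oV KUV; have clK := compact_closed hausdorffT cK.
have clKV : closed (K `&` ~` V) by apply: closedI => //; exact: open_closedC.
have [W /set_nbhsP[W' [oW' KW' W'W]] WU] :
    filter_from (set_nbhs (K `&` ~` V)) closure U.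
  apply: normalT => //; apply/set_nbhsP; exists U; split => // x [Kx nVx].
  by case: (KUV x Kx).
exists (K `&` closure W), (K `&` ~` W'); split.
- by apply: compact_closedI => //; exact: closed_closure.
- by apply: compact_closedI => //; exact: open_closedC.
- by move=> x [_ /WU].
- by move=> x [Kx nW'x]; apply: contrapT => nVx; apply: nW'x; exact: KW'.
- move=> x Kx; have [W'x|nW'x] := pselect (W' x); last by right.
  by left; split => //; exact/subset_closure/W'W.
Qed.

Lemma inner_cap_ge0 (U : set T) : (0 <= inner_cap U)%E.
Proof.
apply: (le_trans (c_ge0 set0)); apply: ereal_sup_ubound; exists set0 => //.
by split => //; exact: compact0.
Qed.

(** A compact K in the union splits into K1 in U and K2 in V. Adding to both a compact L of the
    intersection gives two compact sets whose union contains K and whose intersection contains L. *)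
Lemma inner_cap_strong_subadd (U V : set T) : open U -> open V ->
  (inner_cap (U `|` V) + inner_cap (U `&` V) <= inner_cap U + inner_cap V)%E.
Proof.
move=> oU oV; apply: ereal_supD_le.
- by exists (c set0), set0 => //; split => //; exact: compact0.
- by exists (c set0), set0 => //; split => //; exact: compact0.
- by move=> _ [K _ <-].
- by move=> _ [K _ <-].
move=> _ _ [K [cK KUV] <-] [L [cL LUV] <-].
have [K1 [K2 [cK1 cK2 K1U K2V KK]]] := compact_splitU cK oU oV KUV.
have cK1L : compact (K1 `|` L) by apply: compactU.
have cK2L : compact (K2 `|` L) by apply: compactU.
apply: (@le_trans _ _
  (c ((K1 `|` L) `|` (K2 `|` L)) + c ((K1 `|` L) `&` (K2 `|` L)))%E).
  apply: leeD; apply: le_c; first by move=> x /KK[]; [left; left|right; left].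
  by move=> x Lx; split; right.
apply: (le_trans (c_subadd cK1L cK2L)); apply: leeD; apply: ereal_sup_ubound.
  by exists (K1 `|` L) => //; split => // x [/K1U//|/LUV[]].
by exists (K2 `|` L) => //; split => // x [/K2V//|/LUV[]].
Qed.

Lemma inner_cap_bigcup (U : nat -> set T) : (forall n, open (U n)) ->
  (forall i j, (i <= j)%N -> U i `<=` U j) ->
  (inner_cap (\bigcup_n U n) <= ereal_sup (range (inner_cap \o U)))%E.
Proof.
move=> oU ndU; apply: ge_ereal_sup => _ [K [cK KU] <-].
suff [n KUn] : exists n, K `<=` U n.
  apply: (@le_trans _ _ (inner_cap (U n))).
    by apply: ereal_sup_ubound; exists K.
  by apply: ereal_sup_ubound; exists n.
(* Each point of K has a neighbourhood contained in U n for all large n; compactness makes n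
   uniform. *)
have := cK; rewrite compact_near_coveringP => /(_ nat \oo (fun n => U n)).
case.
  move=> x /KU[n _ Unx]; exists (U n, [set k | (n <= k)%N]).
    by split => /=; [apply: open_nbhs_nbhs | exists n].
  by move=> -[y k] /= [Uny nk]; exact: (ndU n k nk).
by move=> n _ /(_ n) /= Kn; exists n; exact: Kn.
Qed.

Lemma le_outer_cap (A B : set T) : A `<=` B -> (outer_cap A <= outer_cap B)%E.
Proof.
move=> AB; apply: le_ereal_inf_tmp => _ [U [oU BU] <-].
by apply: ereal_inf_lbound; exists U => //; split => //; exact: subset_trans BU.
Qed.

Lemma outer_cap_ge0 (A : set T) : (0 <= outer_cap A)%E.
Proof. by apply: le_ereal_inf_tmp => _ [U _ <-]; exact: inner_cap_ge0. Qed.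

Lemma outer_cap_le_inner (A U : set T) : open U -> A `<=` U ->
  (outer_cap A <= inner_cap U)%E.
Proof. by move=> oU AU; apply: ereal_inf_lbound; exists U. Qed.

Lemma outer_cap_strong_subadd (A B : set T) :
  (outer_cap (A `|` B) + outer_cap (A `&` B) <= outer_cap A + outer_cap B)%E.
Proof.
apply: le_ereal_infD.
- by move=> _ [U _ <-]; exact: inner_cap_ge0.
- by move=> _ [U _ <-]; exact: inner_cap_ge0.
move=> _ _ [U [oU AU] <-] [V [oV BV] <-].
apply: (le_trans _ (inner_cap_strong_subadd oU oV)); apply: leeD.
  by apply: outer_cap_le_inner; [exact: openU|exact: setUSS].
by apply: outer_cap_le_inner; [exact: openI|exact: setISS].
Qed.

Lemma outer_cap_subadd (A B : set T) :
  (outer_cap (A `|` B) <= outer_cap A + outer_cap B)%E.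
Proof.
apply: (le_trans _ (outer_cap_strong_subadd A B)).
by rewrite leeDl// outer_cap_ge0.
Qed.

Lemma outer_cap_open_approx (A : set T) (e : R) : 0 < e ->
  outer_cap A \is a fin_num ->
  exists U, [/\ open U, A `<=` U & (inner_cap U <= outer_cap A + e%:E)%E].
Proof.
move=> e0 fA; have [_ [U [oU AU] <-] Ue] := lb_ereal_inf_adherent e0 fA.
by exists U; split => //; exact: ltW.
Qed.

Lemma outer_cap_decr (K : nat -> set T) : (forall i, compact (K i)) ->
  (forall i, K i.+1 `<=` K i) ->
  outer_cap (K i) @[i --> \oo] --> outer_cap (\bigcap_i K i).
Proof.
move=> cK decK.
have niK i j : (i <= j)%N -> K j `<=` K i.
  elim: j => [|j IH]; first by rewrite leqn0 => /eqP ->.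
  rewrite leq_eqVlt => /predU1P[->//|]; rewrite ltnS => /IH.
  by move=> h x /decK/h.
have niC : {homo outer_cap \o K : n m / (n <= m)%N >-> (m <= n)%E}.
  by move=> n m nm; apply/le_outer_cap/niK.
suff -> : outer_cap (\bigcap_i K i) = ereal_inf (range (outer_cap \o K)).
  exact: ereal_nonincreasing_cvgn.
apply/eqP; rewrite eq_le; apply/andP; split.
  by apply: le_ereal_inf_tmp => _ [i _ <-]; apply: le_outer_cap => x; exact.
apply: le_ereal_inf_tmp => _ [U [oU KU] <-].
suff [n KnU] : exists n, K n `<=` U.
  apply: (@le_trans _ _ (outer_cap (K n))).
    by apply: ereal_inf_lbound; exists n.
  exact: outer_cap_le_inner.
(* A point of [K 0] lies in U or outside some closed [K n], and both conditions are open and persist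
   for larger n. Compactness of [K 0] gives one n for all points, that is, [K n] contained in U. *)
have /compact_near_coveringP := cK 0%N.
move=> /(_ nat \oo (fun n x => (U `|` ~` K n) x)); case.
  move=> x K0x; have [Ux|nUx] := pselect (U x).
    exists (U, setT); first by split; [exact: open_nbhs_nbhs|exact: filterT].
    by move=> -[y k] /= [Uy _]; left.
  have [n nKnx] : exists n, ~ K n x.
    apply: contrapT => /forallNP h; apply: nUx; apply: KU => n _.
    by apply: contrapT; exact: h.
  exists (~` K n, [set k | (n <= k)%N]).
    split => /=; last by exists n.
    apply: open_nbhs_nbhs; split => //.
    by apply: closed_openC; exact: compact_closed.
  by move=> -[y k] /= [nKny nk]; right => Kky; apply: nKny; exact: (niK _ _ nk).
move=> n _ /(_ n) /= Kn; exists n => x Knx.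
by case: (Kn (leqnn n) x (niK 0%N n (leq0n n) _ Knx)).
Qed.

(** Nearly optimal open sets U n around A n need not increase, so they are replaced by their finite
    unions V n. Strong subadditivity keeps the accumulated error below e. *)
Lemma outer_cap_bigcup (A : nat -> set T) : (forall i, A i `<=` A i.+1) ->
  outer_cap (\bigcup_i A i) = ereal_sup (range (outer_cap \o A)).
Proof.
move=> incA; set s := ereal_sup _.
apply/eqP; rewrite eq_le; apply/andP; split; last first.
  by apply: ge_ereal_sup => _ [i _ <-]; apply: le_outer_cap => x Aix; exists i.
have le_s n : (outer_cap (A n) <= s)%E by apply: ereal_sup_ubound; exists n.
have s0 : (0 <= s)%E by apply: (le_trans _ (le_s 0%N)); exact: outer_cap_ge0.
have [->|soo] := eqVneq s +oo%E; first exact: leey.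
have fs : s \is a fin_num by rewrite ge0_fin_numE// lt_neqAle soo leey.
have fA n : outer_cap (A n) \is a fin_num.
  rewrite ge0_fin_numE ?outer_cap_ge0//; apply: (le_lt_trans (le_s n)).
  by rewrite ltey.
apply/lee_addgt0Pr => e e0.
pose w n : R := e * 2^-1 ^+ n.+1.
have w0 n : 0 < w n by rewrite mulr_gt0// exprn_gt0// invr_gt0.
have /choice[U hU] : forall n, exists U, [/\ open U, A n `<=` U &
    (inner_cap U <= outer_cap (A n) + (w n)%:E)%E].
  by move=> n; exact: outer_cap_open_approx.
pose V n := \bigcup_(i in [set i | (i <= n)%N]) U i.
have oV n : open (V n) by apply: bigcup_open => i _; case: (hU i).
have ndV i j : (i <= j)%N -> V i `<=` V j.
  by move=> ij x [k /= ki Ukx]; exists k => //=; exact: leq_trans ij.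
have AV n : A n `<=` V n.
  by move=> x Anx; exists n => //=; case: (hU n) => _ + _; exact.
have V_S n : V n.+1 = V n `|` U n.+1.
  apply/seteqP; split => x.
    move=> [k /=]; rewrite leq_eqVlt => /predU1P[->|]; first by right.
    by rewrite ltnS => kn Ukx; left; exists k.
  by move=> [[k /= kn Ukx]|Ux]; [exists k => //=; exact: leqW|exists n.+1 => /=].
(* The bound is w 0 + ... + w n = e - w n. In the induction step the intersection of V n and U (n +
   1) contains A n, so its capacity cancels the term outer_cap (A n) of the induction hypothesis. *)
have bV n : (inner_cap (V n) <= outer_cap (A n) + (e - w n)%:E)%E.
  elim: n => [|n IH].
    have -> : V 0%N = U 0%N.
      apply/seteqP; split => x; last by exists 0%N => /=.
      by move=> [k /=]; rewrite leqn0 => /eqP ->.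
    have w0E : w 0%N = e - w 0%N by rewrite /w expr1; field.
    by rewrite -w0E; case: (hU 0%N).
  have [oU AU UA] := hU n.+1.
  have AI : A n `<=` V n `&` U n.+1.
    by move=> x Anx; split; [exact: AV|exact/AU/incA].
  have := le_trans (inner_cap_strong_subadd (oV n) oU) (leeD IH UA).
  have /(leeD (lexx (inner_cap (V n.+1)))) :=
    outer_cap_le_inner (openI (oV n) oU) AI.
  rewrite -V_S => /le_trans/[apply].
  have -> : (e - w n.+1)%:E = ((e - w n)%:E + (w n.+1)%:E)%E.
    by rewrite -EFinD; congr EFin; rewrite /w !exprS; field.
  move: (fA n) (fA n.+1) => /fineK <- /fineK <-.
  case: (inner_cap (V n.+1)) => [r||]; rewrite -?EFinD ?lee_fin ?leNye//.
  by lra.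
apply: (@le_trans _ _ (inner_cap (\bigcup_n V n))).
  by apply: outer_cap_le_inner; [exact: bigcup_open|move=> x [n _ /AV]; exists n].
apply: (le_trans (inner_cap_bigcup oV ndV)); apply: ge_ereal_sup => _ [n _ <-].
apply: (le_trans (bV n)); apply: leeD => //.
by rewrite lee_fin gerBl ltW.
Qed.

Lemma outer_cap_choquet : choquet_capacity outer_cap.
Proof.
split; [exact: le_outer_cap|exact: outer_cap_decr|move=> A incA].
rewrite outer_cap_bigcup//; apply: ereal_nondecreasing_cvgn.
by apply/nondecreasing_seqP => n; exact: le_outer_cap.
Qed.

(** Finite subadditivity bounds the capacity of the finite unions [B n], and [outer_cap_bigcup]
    passes to their increasing limit. *)
Lemma outer_cap_sigma_subadd (A : nat -> set T) :
  (outer_cap (\bigcup_i A i) <= \sum_(0 <= i <oo) outer_cap (A i))%E.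
Proof.
pose B n := \bigcup_(i in [set i | (i <= n)%N]) A i.
have -> : \bigcup_i A i = \bigcup_n B n.
  apply/seteqP; split => [x [i _ Aix]|x [n _ [i _ Aix]]]; last by exists i.
  by exists i => //; exists i => /=.
rewrite outer_cap_bigcup; last first.
  by move=> n x [i /= ni Aix]; exists i => //=; exact: leqW.
apply: ge_ereal_sup => _ [n _ <-] /=.
apply: (@le_trans _ _ (\sum_(0 <= i < n.+1) outer_cap (A i))%E); last first.
  by apply: nneseries_lim_ge => i _ _; exact: outer_cap_ge0.
elim: n => [|n IH].
  rewrite big_nat1; apply: le_outer_cap => x [k /=].
  by rewrite leqn0 => /eqP ->.
rewrite big_nat_recr//=; apply: (le_trans _ (leeD IH (lexx _))).
apply: (le_trans _ (outer_cap_subadd _ _)); apply: le_outer_cap => x [k /=].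
rewrite leq_eqVlt => /predU1P[->|]; first by right.
by rewrite ltnS => kn Ukx; left; exists k.
Qed.

End outer_capacity.

(** * Integrals *)

Section integrable_complements.
Context {d : measure_display} {T : measurableType d} {R : realType}.
Variable m : {measure set T -> \bar R}.
Implicit Types (u v : T -> R).
Local Notation integrable u := (m.-integrable [set: T] (EFin \o (u : T -> R))).

Lemma ae_eqW (u v : T -> R) : (\forall x \ae m, u x = v x) <-> u = v %[ae m].
Proof. by split; apply: filterS => x //; apply. Qed.

Lemma ae_and (P Q : T -> Prop) : (\forall x \ae m, P x) ->
  (\forall x \ae m, Q x) -> \forall x \ae m, P x /\ Q x.
Proof. exact: filterS2. Qed.

Lemma ae_integrable u v : measurable_fun [set: T] v ->
  (\forall x \ae m, u x = v x) -> integrable u -> integrable v.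
Proof.
move=> mv uv /integrableP[/measurable_EFinP mu ifu].
apply/integrableP; split; first exact/measurable_EFinP.
rewrite -(@ge0_ae_eq_integral _ _ _ _ _ (fun x => `|(u x)%:E|%E))//.
- by apply: measurableT_comp => //; exact/measurable_EFinP.
- by apply: measurableT_comp => //; exact/measurable_EFinP.
- by apply: filterS uv => x /= -> _.
Qed.

Lemma ae_eq_Rintegral u v : integrable u -> measurable_fun [set: T] v ->
  (\forall x \ae m, u x = v x) -> (\int[m]_x u x = \int[m]_x v x)%R.
Proof.
move=> /integrableP[mu _] mv uv; congr fine; apply: ae_eq_integral => //.
  exact/measurable_EFinP.
by apply: filterS uv => x /= -> _.
Qed.

(** Replacing [v] by [u \max v], which equals it a.e., turns the inequality into one that holds
    everywhere. *)
Lemma ae_le_Rintegral u v : integrable u -> integrable v ->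
  (\forall x \ae m, u x <= v x) -> (\int[m]_x u x <= \int[m]_x v x)%R.
Proof.
move=> iu iv uv.
have mu : measurable_fun [set: T] u by case/integrableP: iu => /measurable_EFinP.
have mv : measurable_fun [set: T] v by case/integrableP: iv => /measurable_EFinP.
have mM : measurable_fun [set: T] (u \max v) by exact: measurable_maxr.
have vM : \forall x \ae m, v x = Num.max (u x) (v x).
  by apply: filterS uv => x uv; rewrite max_r.
rewrite (ae_eq_Rintegral iv mM vM); apply: le_Rintegral => //.
  exact: ae_integrable vM iv.
by move=> x _ /=; rewrite le_max lexx.
Qed.

Lemma Rintegral_eq0_ae u : integrable u -> (forall x, 0 <= u x) ->
  (\int[m]_x u x = 0)%R -> \forall x \ae m, u x = 0.
Proof.
move=> iu u0 intu0; have /integrableP[mu ifu] := iu.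
have : (\int[m]_x `|(EFin \o u) x| = 0)%E.
  under eq_integral do rewrite /= ger0_norm//.
  rewrite -[LHS]fineK; first by move: intu0; rewrite /Rintegral => ->.
  exact: integrable_fin_num.
move=> /(ae_eq_integral_abs m measurableT mu); apply: filterS => x /(_ I) /=.
by case.
Qed.

Lemma ge0_Rintegral_ae u : integrable u -> (\forall x \ae m, 0 <= u x) ->
  0 <= (\int[m]_x u x)%R.
Proof.
move=> iu u0; have <- : (\int[m]_x (cst 0 x) = 0 :> R)%R.
  by rewrite /Rintegral integral0.
by apply: ae_le_Rintegral => //; exact: integrable0.
Qed.

Lemma ge0_Rintegral_eq0_ae u : integrable u -> (\forall x \ae m, 0 <= u x) ->
  (\int[m]_x u x <= 0)%R -> \forall x \ae m, u x = 0.
Proof.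
move=> iu u0 intu0.
have mu : measurable_fun [set: T] u by case/integrableP: iu => /measurable_EFinP.
have mM : measurable_fun [set: T] (u \max cst 0) by exact: measurable_maxr.
have uM : \forall x \ae m, u x = Num.max (u x) 0.
  by apply: filterS u0 => x u0; rewrite max_l.
have iM := ae_integrable mM uM iu.
have : \forall x \ae m, Num.max (u x) 0 = 0.
  apply: (@Rintegral_eq0_ae (u \max cst 0)) => //.
    by move=> x /=; rewrite le_max lexx orbT.
  rewrite -(ae_eq_Rintegral iu mM uM); apply/eqP; rewrite eq_le intu0 /=.
  exact: ge0_Rintegral_ae.
by apply: filterS2 uM => x <-.
Qed.

Lemma LfunP (r : R) u : 1 <= r -> u \in Lfun m r%:E <->
  measurable_fun [set: T] u /\ m.-integrable [set: T] (fun x => (`|u x| `^ r)%:E).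
Proof.
move=> r1; split=> [Lu|[mu iu]].
  split; last exact: Lfun_integrable.
  by move: Lu; rewrite inE => /andP[]; rewrite inE.
rewrite inE; apply/andP; split; rewrite inE//=.
by rewrite /finite_norm unlock poweR_lty//; exact: integrable_lty.
Qed.

Lemma Lfun_measurable (r : \bar R) u : u \in Lfun m r -> measurable_fun [set: T] u.
Proof. by rewrite inE => /andP[]; rewrite inE. Qed.

Lemma le_Lfun (r : R) u v : 1 <= r -> measurable_fun [set: T] v ->
  (forall x, `|v x| <= `|u x|) -> u \in Lfun m r%:E -> v \in Lfun m r%:E.
Proof.
move=> r1 mv vu /(LfunP u r1)[mu iu]; apply/LfunP => //; split => //.
apply: (le_integrable _ _ _ iu) => //.
  apply/measurable_EFinP; apply: (measurableT_comp (measurable_powR _)).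
  exact: measurableT_comp.
move=> x _; rewrite /= lee_fin !(ger0_norm (powR_ge0 _ _)).
by apply: ge0_ler_powR; rewrite ?nnegrE ?vu//; lra.
Qed.

Lemma ae_Lfun (r : R) u v : 1 <= r -> measurable_fun [set: T] v ->
  (\forall x \ae m, u x = v x) -> u \in Lfun m r%:E -> v \in Lfun m r%:E.
Proof.
move=> r1 mv vu /(LfunP u r1)[mu iu]; apply/LfunP => //; split => //.
apply: (@ae_integrable (fun x => `|u x| `^ r)) => //.
  by apply: (measurableT_comp (measurable_powR _)); exact: measurableT_comp.
by apply: filterS vu => x ->.
Qed.

Lemma LfunD (r : R) u v : 1 <= r -> u \in Lfun m r%:E -> v \in Lfun m r%:E ->
  u \+ v \in Lfun m r%:E.
Proof.
move=> r1 Lu Lv.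
by have [_ /(_ u v Lu Lv)] := @Lfun_addr_closed _ _ _ m r%:E r1.
Qed.

Lemma bounded_Lfun (M : R) u : measurable_fun [set: T] u ->
  (forall x, `|u x| <= M) -> u \in Lfun m +oo%E.
Proof.
move=> mu uM; rewrite inE; apply/andP; split; rewrite inE//=.
rewrite /finite_norm unlock; case: ifPn => // _.
apply: (@le_lt_trans _ _ M%:E); last exact: ltry.
by apply/ess_supP; apply: aeW => x /=; rewrite lee_fin.
Qed.

End integrable_complements.

Section square_integral.
Context {d : measure_display} {T : measurableType d} {R : realType}.
Variable m : {finite_measure set T -> \bar R}.
Implicit Types (u v : T -> R).

Definition L2 u := u \in Lfun m 2%:E.

Definition sqint u : R := (\int[m]_x (u x ^+ 2))%R.

Let two_ge1 : 1 <= 2 :> R. Proof. by rewrite ler1n. Qed.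

Lemma L2_integrable u : L2 u -> m.-integrable [set: T] (EFin \o (fun x => u x ^+ 2)).
Proof. exact: Lfun2_integrable_sqr. Qed.

Lemma L2_measurable u : L2 u -> measurable_fun [set: T] u.
Proof. exact: Lfun_measurable. Qed.

Lemma L2Z a u : L2 u -> L2 (fun x => a * u x).
Proof.
move=> Lu; have -> : (fun x => a * u x) = a \o* u.
  by apply/funext => x /=; rewrite mulrC.
exact: Lfun_scale.
Qed.

Lemma L2D u v : L2 u -> L2 v -> L2 (u \+ v).
Proof. by move=> Lu Lv; exact: LfunD. Qed.

Lemma L2B u v : L2 u -> L2 v -> L2 (u \- v).
Proof.
move=> Lu Lv; have -> : u \- v = u \+ (fun x => -1 * v x).
  by apply/funext => x /=; rewrite mulN1r.
by apply: L2D => //; exact: L2Z.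
Qed.

Lemma L2cst (a : R) : L2 (cst a).
Proof. exact: Lfun_cst. Qed.

Lemma le_L2 u v : measurable_fun [set: T] v -> (forall x, `|v x| <= `|u x|) ->
  L2 u -> L2 v.
Proof. exact: le_Lfun. Qed.

Lemma sqint_ge0 u : 0 <= sqint u.
Proof. by apply: Rintegral_ge0 => x _; exact: sqr_ge0. Qed.

Lemma le_sqint u v : L2 u -> L2 v -> (forall x, `|v x| <= `|u x|) ->
  sqint v <= sqint u.
Proof.
move=> Lu Lv vu; apply: le_Rintegral => //; try exact: L2_integrable.
by move=> x _; rewrite -(real_normK (num_real (v x))) -(real_normK (num_real (u x)));
  rewrite ler_sqr ?nnegrE.
Qed.

Lemma sqint_cst (a : R) : sqint (cst a) = a ^+ 2 * fine (m [set: T]).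
Proof. by rewrite /sqint /= Rintegral_cst. Qed.

Lemma sqint_parallelogram u v : L2 u -> L2 v ->
  sqint (u \+ v) + sqint (u \- v) = 2 * sqint u + 2 * sqint v.
Proof.
move=> Lu Lv; rewrite /sqint.
rewrite -RintegralD//; [|exact: (L2_integrable (L2D Lu Lv))
                        |exact: (L2_integrable (L2B Lu Lv))].
rewrite -!RintegralZl//; try exact: L2_integrable.
rewrite -RintegralD//.
- by apply: eq_Rintegral => x _ /=; ring.
- by apply: (integrableZl measurableT 2 (L2_integrable Lu)).
- by apply: (integrableZl measurableT 2 (L2_integrable Lv)).
Qed.

Lemma sqintD_le u v : L2 u -> L2 v ->
  sqint (u \+ v) <= 2 * sqint u + 2 * sqint v.
Proof. by move=> Lu Lv; rewrite -sqint_parallelogram// lerDl sqint_ge0. Qed.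

Lemma sqintZ a u : L2 u -> sqint (fun x => a * u x) = a ^+ 2 * sqint u.
Proof.
move=> Lu; rewrite /sqint -RintegralZl//; last exact: L2_integrable.
by apply: eq_Rintegral => x _; rewrite exprMn.
Qed.

Lemma sqintN u v : sqint (u \- v) = sqint (v \- u).
Proof. by apply: eq_Rintegral => x _ /=; rewrite -sqrrN opprB. Qed.

Lemma sqint_trans v u w : L2 u -> L2 v -> L2 w ->
  sqint (u \- w) <= 2 * sqint (u \- v) + 2 * sqint (v \- w).
Proof.
move=> Lu Lv Lw.
have -> : u \- w = (u \- v) \+ (v \- w) by apply/funext => x /=; ring.
by apply: sqintD_le; exact: L2B.
Qed.

Lemma sqint_eq0 u : L2 u -> sqint u = 0 -> \forall x \ae m, u x = 0.
Proof.
move=> Lu su0; have := Rintegral_eq0_ae (L2_integrable Lu) (fun x => sqr_ge0 _) su0.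
by apply: filterS => x /eqP; rewrite sqrf_eq0 => /eqP.
Qed.

End square_integral.

(** * Dirichlet forms *)

Definition energy {T S : Type} (E : (T -> S) -> (T -> S) -> S) u : S := E u u.

Definition midpoint {T : Type} {R : realType} (u v : T -> R) : T -> R :=
  fun x => 2^-1 * (u x + v x).

Section dirichlet_forms.
Context {d : measure_display} {R : realType} {X : borelMetricType d R}.
Context {m : {finite_measure set X -> \bar R}}.
Context {D : set (X -> R)} {E : (X -> R) -> (X -> R) -> R}.
Hypothesis E_dirichlet : dirichlet_form m D E.
Implicit Types (u v w : X -> R).
Local Notation L2 := (L2 m).
Local Notation sqint := (sqint m).
Local Notation energy := (energy E).

Lemma dom_L2 u : D u -> L2 u.
Proof. exact: (df_L2 E_dirichlet). Qed.

Lemma eq_dom u v : u =1 v -> D u -> D v.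
Proof. by move=> /funext ->. Qed.

Lemma domZ a u : D u -> D (fun x => a * u x).
Proof.
move=> Du; have := df_dom_lin E_dirichlet a Du (df_dom0 E_dirichlet).
by apply: eq_dom => x /=; rewrite addr0.
Qed.

Lemma domD u v : D u -> D v -> D (u \+ v).
Proof.
move=> Du Dv; have := df_dom_lin E_dirichlet 1 Du Dv.
by apply: eq_dom => x /=; rewrite mul1r.
Qed.

Lemma domB u v : D u -> D v -> D (u \- v).
Proof.
move=> Du Dv; have := df_dom_lin E_dirichlet (-1) Dv Du.
by apply: eq_dom => x /=; rewrite mulN1r addrC.
Qed.

Lemma formDl u v w : D u -> D v -> D w -> E (u \+ v) w = E u w + E v w.
Proof.
move=> Du Dv Dw; have := df_form_lin E_dirichlet 1 Du Dv Dw.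
by rewrite mul1r => <-; congr (E _ w); apply/funext => x /=; rewrite mul1r.
Qed.

Lemma formBl u v w : D u -> D v -> D w -> E (u \- v) w = E u w - E v w.
Proof.
move=> Du Dv Dw; have := df_form_lin E_dirichlet (-1) Dv Du Dw.
rewrite mulN1r addrC => <-; congr (E _ w).
by apply/funext => x /=; rewrite mulN1r addrC.
Qed.

Lemma form0l w : D w -> E (cst 0) w = 0.
Proof.
move=> Dw; have D0 := df_dom0 E_dirichlet.
have c0 : cst 0 = cst 0 \- cst 0 :> (X -> R) by apply/funext => x /=; rewrite subrr.
by rewrite [in LHS]c0 formBl// subrr.
Qed.

Lemma formZl a u w : D u -> D w -> E (fun x => a * u x) w = a * E u w.
Proof.
move=> Du Dw; have D0 := df_dom0 E_dirichlet.
have := df_form_lin E_dirichlet a Du D0 Dw; rewrite form0l// addr0 => <-.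
by congr (E _ w); apply/funext => x /=; rewrite addr0.
Qed.

Lemma formDr u v w : D u -> D v -> D w -> E w (u \+ v) = E w u + E w v.
Proof.
move=> Du Dv Dw; rewrite (df_form_sym E_dirichlet Dw (domD Du Dv)) formDl//.
by rewrite !(df_form_sym E_dirichlet Dw).
Qed.

Lemma formBr u v w : D u -> D v -> D w -> E w (u \- v) = E w u - E w v.
Proof.
move=> Du Dv Dw; rewrite (df_form_sym E_dirichlet Dw (domB Du Dv)) formBl//.
by rewrite !(df_form_sym E_dirichlet Dw).
Qed.

Lemma formZr a u w : D u -> D w -> E w (fun x => a * u x) = a * E w u.
Proof.
move=> Du Dw; rewrite (df_form_sym E_dirichlet Dw (domZ a Du)) formZl//.
by rewrite !(df_form_sym E_dirichlet Dw).
Qed.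

Lemma energy_ge0 u : D u -> 0 <= energy u.
Proof. exact: (df_form_ge0 E_dirichlet). Qed.

Lemma energyZ a u : D u -> energy (fun x => a * u x) = a ^+ 2 * energy u.
Proof.
by move=> Du; rewrite /energy formZl ?formZr//; [ring|exact: domZ].
Qed.

Lemma energyD u v : D u -> D v ->
  energy (u \+ v) = energy u + 2 * E u v + energy v.
Proof.
move=> Du Dv; rewrite /energy formDl ?formDr//; last exact: domD.
by rewrite (df_form_sym E_dirichlet Dv Du); ring.
Qed.

Lemma energyB u v : D u -> D v ->
  energy (u \- v) = energy u - 2 * E u v + energy v.
Proof.
move=> Du Dv; rewrite /energy formBl ?formBr//; last exact: domB.
by rewrite (df_form_sym E_dirichlet Dv Du); ring.
Qed.

Lemma energyB_le u v : D u -> D v ->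
  energy (u \- v) <= 2 * energy u + 2 * energy v.
Proof.
move=> Du Dv; have := energy_ge0 (domD Du Dv).
by rewrite energyB// energyD//; lra.
Qed.

Lemma energy_ae u v : D u -> D v -> (\forall x \ae m, u x = v x) ->
  energy u = energy v.
Proof.
move=> Du Dv /ae_eqW uv; rewrite /energy (df_form_ae E_dirichlet Du Dv Du uv).
rewrite (df_form_sym E_dirichlet Dv Du).
by rewrite (df_form_ae E_dirichlet Du Dv Dv uv).
Qed.

Lemma form1E u : form1 m E u u = energy u + sqint u.
Proof. by congr (_ + _); apply: eq_Rintegral => x _; rewrite expr2. Qed.

Lemma dom_midpoint u v : D u -> D v -> D (midpoint u v).
Proof. by move=> Du Dv; exact: (domZ _ (domD Du Dv)). Qed.

Lemma energy_midpoint u v : D u -> D v ->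
  energy (u \- v) = 2 * energy u + 2 * energy v - 4 * energy (midpoint u v).
Proof.
move=> Du Dv; rewrite (energyZ _ (domD Du Dv)) energyD// energyB//.
by field.
Qed.

(* A version of Mazur's lemma: the a_ n nearly minimize the energy among the
   points of P at L2-distance less than 1 / (n + 1) from u, and the
   parallelogram identity makes them a Cauchy sequence for the energy. *)
Lemma energy_mazur (P : set (X -> R)) (M : R) u :
  P `<=` D -> (forall a b, P a -> P b -> P (midpoint a b)) ->
  (forall a, P a -> energy a <= M) -> L2 u ->
  (forall e, 0 < e -> exists2 a, P a & sqint (a \- u) < e) ->
  D u /\ forall e, 0 < e -> exists2 a, P a & energy (a \- u) < e.
Proof.
move=> PD Pmid PM Lu Pu.
have [r [r0 ndr r_small]] : exists r : nat -> R, [/\ forall n, 0 < r n,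
    forall i j, (i <= j)%N -> r j <= r i &
    forall e, 0 < e -> exists N, forall n, (N <= n)%N -> r n < e].
  exists (fun n => n.+1%:R^-1); split=> [n|i j ij|e e0].
  - by rewrite invr_gt0.
  - by rewrite lef_pV2 ?posrE// ler_nat.
  - by have [N _ Ne] := near_infty_natSinv_lt (PosNum e0); exists N.
pose C n := [set a | P a /\ sqint (a \- u) < r n].
have CS i j : (i <= j)%N -> C j `<=` C i.
  move=> ij a [Pa au]; split => //; apply: (lt_le_trans au).
  exact: ndr.
pose I n := inf [set energy a | a in C n].
have lbC n : has_lbound [set energy a | a in C n].
  by exists 0 => _ [a [/PD Da _] <-]; exact: energy_ge0.
have C0 n : [set energy a | a in C n] !=set0.
  by have [a Pa au] := Pu _ (r0 n); exists (energy a), a.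
have I_le n a : C n a -> I n <= energy a.
  by move=> Ca; apply: ge_inf => //; exists a.
have ndI i j : (i <= j)%N -> I i <= I j.
  move=> ij; apply: lb_le_inf => // _ [a Ca <-].
  by apply: I_le; exact: CS Ca.
have IM n : I n <= M.
  have [a Pa au] := Pu _ (r0 n).
  by apply: le_trans (PM a Pa); apply: I_le.
have supI : has_sup (range I).
  by split; [exists (I 0%N), 0%N|exists M => _ [n _ <-]].
have /choice[a_ a_P] n : exists a, C n a /\ energy a < I n + r n.
  by have [_ [a Ca <-] aI] := inf_adherent (r0 n) (conj (C0 n) (lbC n)); exists a.
have Da n : D (a_ n) by apply: PD; case: (a_P n) => -[].
have au n : sqint (a_ n \- u) < r n by case: (a_P n) => -[].
have Cmid N i j : (N <= i)%N -> (N <= j)%N -> C N (midpoint (a_ i) (a_ j)).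
  move=> Ni Nj; have [Pi iu] := CS _ _ Ni _ (a_P i).1.
  have [Pj ju] := CS _ _ Nj _ (a_P j).1; split; first exact: Pmid.
  have -> : midpoint (a_ i) (a_ j) \- u =
      (fun x => 2^-1 * ((a_ i \- u) \+ (a_ j \- u)) x).
    by apply/funext => x; rewrite /midpoint /=; field.
  have Lau n : L2 (a_ n \- u) by apply: L2B => //; exact: dom_L2.
  rewrite sqintZ; last exact: L2D.
  have := sqintD_le (Lau i) (Lau j).
  have -> : 2^-1 ^+ 2 = 4^-1 :> R by field.
  by lra.
(* The infima I n increase to a finite supremum s. Far out the energies of a_i and a_j are below s +
   e/16 and that of their midpoint is above s - e/16, so the energy of the difference is below e/2;
   the L^2 part is below e/4. *)
have a_cauchy e : 0 < e -> exists N : nat, forall i j : nat,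
    (N <= i)%N -> (N <= j)%N -> form1 m E (a_ i \- a_ j) (a_ i \- a_ j) < e.
  move=> e0; have e16 : 0 < e / 16 by rewrite divr_gt0.
  have [_ [N1 _ <-] N1s] := sup_adherent e16 supI.
  have [N2 N2e] := r_small _ e16.
  exists (maxn N1 N2) => i j; rewrite !geq_max => /andP[Ni1 Ni2] /andP[Nj1 Nj2].
  have Is n : I n <= sup (range I) by apply: ub_le_sup; [case: supI|exists n].
  have ei := (a_P i).2; have ej := (a_P j).2.
  have := I_le _ _ (Cmid _ _ _ Ni1 Nj1).
  rewrite form1E energy_midpoint//.
  have := sqint_trans (dom_L2 (Da i)) Lu (dom_L2 (Da j)).
  rewrite [X in _ + 2 * X]sqintN.
  have /= := N2e _ Ni2; have /= := N2e _ Nj2.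
  have := au i; have := au j; have := Is i; have := Is j.
  by lra.
have [v Dv /cvgrPdist_lt a_v] := df_closed E_dirichlet Da a_cauchy.
have av_lt e : 0 < e -> exists n : nat,
    [/\ r n < e, energy (a_ n \- v) < e & sqint (a_ n \- v) < e].
  move=> e0; have [N1 _ N1e] := a_v _ e0.
  have [N2 N2e] := r_small _ e0.
  exists (maxn N1 N2); have := N1e _ (leq_maxl N1 N2).
  rewrite /= sub0r normrN form1E.
  have eg := energy_ge0 (domB (Da (maxn N1 N2)) Dv).
  have sg := sqint_ge0 m (a_ (maxn N1 N2) \- v).
  rewrite ger0_norm ?addr_ge0// => h; split.
  - exact: (N2e _ (leq_maxr N1 N2)).
  - by apply: le_lt_trans h; rewrite lerDl.
  - by apply: le_lt_trans h; rewrite lerDr.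
(* Closedness only provides some limit [v]; it agrees with [u] because both are L^2-limits of the
   sequence [a_]. *)
have uv : \forall x \ae m, v x = u x.
  suff : \forall x \ae m, (v \- u) x = 0.
    by apply: filterS => x /= /eqP; rewrite subr_eq0 => /eqP.
  apply: sqint_eq0; first by apply: L2B => //; exact: dom_L2.
  apply/eqP; rewrite eq_le sqint_ge0 andbT; apply/ler_addgt0Pr => e e0.
  have e4 : 0 < e / 4 by rewrite divr_gt0.
  have [n [ne _ av]] := av_lt _ e4.
  have := sqint_trans (dom_L2 Dv) (dom_L2 (Da n)) Lu.
  rewrite [X in _ <= 2 * X + _]sqintN; have := au n.
  by lra.
have Du : D u.
  by apply: (df_dom_ae E_dirichlet Dv) => //; [exact: L2_measurable Lu|exact/ae_eqW].
split => // e e0; have [n [_ av _]] := av_lt _ e0.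
exists (a_ n); first by case: (a_P n) => -[].
rewrite (_ : energy _ = energy (a_ n \- v))//.
apply: energy_ae; [exact: domB|exact: domB|].
by apply: filterS uv => x /= ->.
Qed.

(** The functions of energy at most M form a midpoint-convex set, to which [energy_mazur] applies.
    The factor 2 comes from [energyB_le] on u = a - (a - u); any uniform bound suffices for the
    approximations below. *)
Lemma bounded_energy_closed (M : R) u : L2 u ->
  (forall e, 0 < e -> exists a, [/\ D a, energy a <= M & sqint (a \- u) < e]) ->
  D u /\ energy u <= 2 * M.
Proof.
move=> Lu Mu.
have [|||//||Du Mazur] := @energy_mazur [set a | D a /\ energy a <= M] M u.
- by move=> a [].
- move=> a b [Da aM] [Db bM]; split; first exact: dom_midpoint.
  have := energy_ge0 (domB Da Db); rewrite energy_midpoint//; lra.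
- by move=> a [].
- by move=> e /Mu[a [Da aM au]]; exists a.
split => //; apply/ler_addgt0Pr => e e0; have e2 : 0 < e / 2 by rewrite divr_gt0.
have [a [Da aM] au] := Mazur _ e2.
have := energyB_le Da (domB Da Du).
rewrite (_ : a \- (a \- u) = u); first by lra.
by apply/funext => x /=; ring.
Qed.

(** The unit contraction is applied to u / c and the result is multiplied by c. *)
Lemma dom_clip (c : R) u : 0 < c -> D u ->
  let v := fun x => Num.min (Num.max (u x) 0) c in D v /\ energy v <= energy u.
Proof.
move=> c0 Du; have [Dv Ev] := df_markov E_dirichlet (domZ c^-1 Du).
have -> : (fun x => Num.min (Num.max (u x) 0) c) =
    (fun x => c * Num.min (Num.max (c^-1 * u x) 0) 1).
  apply/funext => x; rewrite minr_pMr ?ltW// maxr_pMr ?ltW//.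
  by rewrite mulr0 mulr1 mulrA divff ?mul1r// gt_eqF.
split; first exact: domZ.
rewrite energyZ//; apply: (@le_trans _ _ (c ^+ 2 * energy (fun x => c^-1 * u x))).
  by rewrite ler_wpM2l// sqr_ge0.
by rewrite energyZ// mulrA -exprMn divff ?gt_eqF// expr1n mul1r.
Qed.

Lemma dominated_sqint_cvg0 u (f_ : nat -> X -> R) : L2 u ->
  (forall n, measurable_fun [set: X] (f_ n)) ->
  (forall n x, `|f_ n x| <= `|u x|) ->
  (forall x, exists N : nat, forall n, (N <= n)%N -> f_ n x = 0) ->
  forall e, 0 < e -> exists n, sqint (f_ n) < e.
Proof.
move=> Lu mf fu f0 e e0.
have Lf n : L2 (f_ n) by exact: le_L2 Lu.
have [||||//|_ _] := @dominated_convergence _ _ _ m [set: X] measurableT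
  (fun n x => (f_ n x ^+ 2)%:E) (cst 0%E) (fun x => (u x ^+ 2)%:E).
- by move=> n; have /integrableP[] := L2_integrable (Lf n).
- exact: measurable_cst.
- apply: aeW => x _; have [N fN] := f0 x.
  apply: cvg_near_cst; exists N => // n /= Nn.
  by rewrite fN// expr0n.
- exact: L2_integrable.
- apply: aeW => x n _; rewrite /= lee_fin ger0_norm ?sqr_ge0//.
  rewrite -(real_normK (num_real (f_ n x))) -(real_normK (num_real (u x))).
  by rewrite ler_sqr ?nnegrE.
rewrite integral0 => /fine_cvgP[_ /cvgrPdist_lt/(_ _ e0)[N _ Ne]].
exists N; have /= := Ne N (leqnn N).
rewrite sub0r normrN ger0_norm//; exact: sqint_ge0.
Qed.

(** The positive part is the L^2-limit of its truncations at height n + 1, whose energies are at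
    most that of u by [dom_clip]. *)
Lemma dom_pos u : D u ->
  let v := fun x => Num.max (u x) 0 in D v /\ energy v <= 2 * energy u.
Proof.
move=> Du v; have Lu := dom_L2 Du; have mu := L2_measurable Lu.
have mv : measurable_fun [set: X] v by exact: measurable_maxr.
have vu x : `|v x| <= `|u x|.
  rewrite /v ger0_norm; last by rewrite le_max lexx orbT.
  by rewrite ge_max ler_norm normr_ge0.
apply: bounded_energy_closed; first exact: le_L2 Lu.
pose f n x := Num.min (v x) n.+1%:R - v x.
move=> e e0; have [n fe] : exists n, sqint (f n) < e.
  apply: (@dominated_sqint_cvg0 u) => //.
  - move=> n; apply: measurable_funB => //.
    by apply: measurable_minr => //; exact: measurable_cst.
  - move=> n x; apply: le_trans (vu x).
    have v0 : 0 <= v x by rewrite le_max lexx orbT.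
    rewrite /f (ger0_norm v0); case: (leP (v x) n.+1%:R) => vn.
      by rewrite subrr normr0.
    by rewrite ltr0_norm ?subr_lt0// opprB gerBl.
  - move=> x; exists (Num.truncn (v x)) => n Nn; rewrite /f min_l ?subrr//.
    apply: ltW; apply: (lt_le_trans (truncnS_gt (v x))).
    by rewrite ler_nat ltnS.
have [Dc Ec] := @dom_clip n.+1%:R u (ltr0Sn _ _) Du.
by exists (fun x => Num.min (v x) n.+1%:R).
Qed.

Lemma posB_clipE (c t : R) : 0 <= c ->
  Num.max (t - c) 0 = Num.max t 0 - Num.min (Num.max t 0) c.
Proof.
move=> c0; have [t0|t0] := leP t 0.
  by rewrite (min_l c0) subr0; case: leP => // ?; lra.
by have [tc|tc] := leP t c; case: leP => ?; lra.
Qed.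

(** The function (u - c)^+ is the difference of u^+ and of the clip of u at height c. Their energies
    are at most 2 and 1 times that of u, whence 6 = 2 * 2 + 2 * 1. *)
Lemma dom_posB (c : R) u : 0 <= c -> D u ->
  let v := fun x => Num.max (u x - c) 0 in D v /\ energy v <= 6 * energy u.
Proof.
move=> + Du; have [Dp Ep] := dom_pos Du; rewrite le_eqVlt => /predU1P[<-|c0] v.
  rewrite /v; under eq_fun do rewrite subr0.
  by split => //; have := energy_ge0 Du; lra.
have [Dc Ec] := dom_clip c0 Du.
have -> : v = (fun x => Num.max (u x) 0) \- (fun x => Num.min (Num.max (u x) 0) c).
  by apply/funext => x /=; rewrite /v posB_clipE// ltW.
split; first exact: domB.
by have := energyB_le Dp Dc; lra.
Qed.

Lemma dom_sum (C : R) n (a_ : nat -> X -> R) : (forall i, D (a_ i)) ->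
  (forall i, energy (a_ i) <= C) ->
  let s := fun x => \sum_(i < n) a_ i x in D s /\ energy s <= n%:R ^+ 2 * C.
Proof.
move=> Da aC; elim: n => [|n [Ds Es]] /=.
  under eq_fun do rewrite big_ord0.
  by split; [exact: df_dom0 E_dirichlet|rewrite /energy form0l ?expr0n ?mul0r//;
    exact: df_dom0 E_dirichlet].
have -> : (fun x => \sum_(i < n.+1) a_ i x) =
    (fun x => \sum_(i < n) a_ i x) \+ a_ n.
  by apply/funext => x /=; rewrite big_ord_recr.
split; first exact: domD.
rewrite energyD//.
(* Positivity at s - n a_n plays the role of Cauchy-Schwarz: 2 n E(s, a_n) is at most energy s + n^2
   energy a_n, hence at most 2 n^2 C. Dividing by n requires treating n = 0 apart. *)
have := energy_ge0 (domB Ds (domZ n%:R (Da n))).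
rewrite energyB ?energyZ ?formZr//; last exact: domZ.
have := aC n; rewrite -[n.+1%:R]natr1 sqrrD1.
case: n {Ds} Es => [|n]; set b := E _ _; set a := energy (a_ _); set S := energy _.
  rewrite expr0n /= !mul0r !addr0 => S0 aC0 _.
  suff -> : b = 0 by rewrite mul0rn; lra.
  rewrite /b (_ : (fun x => _) = cst 0) ?form0l//.
  by apply/funext => x; rewrite big_ord0.
have k0 : 0 < n.+1%:R :> R by [].
move: k0; set k := n.+1%:R => k0 SC aC' h.
have kaC : k ^+ 2 * a <= k ^+ 2 * C by rewrite ler_wpM2l// sqr_ge0.
have bC : b <= k * C by rewrite -(ler_pM2l k0); lra.
by rewrite mulr2n !mulrDl mul1r; lra.
Qed.

End dirichlet_forms.

(** * Carre du champ *)

(** The sum is a left Riemann sum, with step h, of the integral of 2 (t - s)^+ over s in [0, n h],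
    which equals t^2 - ((t - n h)^+)^2. The integrand decreases and each step overshoots by at most
    h^2. *)
Lemma square_approx {R : realType} (h t : R) n : 0 <= h -> 0 <= t ->
  0 <= \sum_(i < n) (2 * h * Num.max (t - i%:R * h) 0)
       + Num.max (t - n%:R * h) 0 ^+ 2 - t ^+ 2 <= n%:R * h ^+ 2.
Proof.
move=> h0 t0; elim: n => [|n /andP[]].
  by rewrite big_ord0 !mul0r subr0 max_l// add0r subrr lexx.
rewrite big_ord_recr/=; set s := \sum_(i < n) _; set y := t - n%:R * h.
have -> : t - n.+1%:R * h = y - h by rewrite -[n.+1%:R]natr1 /y; ring.
have -> : n.+1%:R * h ^+ 2 = n%:R * h ^+ 2 + h ^+ 2.
  by rewrite -[n.+1%:R]natr1; ring.
move: s y (n%:R * h ^+ 2) => s y k l r; apply/andP.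
have := sqr_ge0 (h - y); rewrite sqrrB; have h2 := sqr_ge0 h.
have [y0|y0] := leP y 0; have [yh|yh] := leP (y - h) 0 => sq.
- by split; rewrite ?expr0n ?mulr0; move: l r; rewrite max_r// expr0n/=; lra.
- by lra.
- have hy : 0 <= y * (2 * h - y) by rewrite mulr_ge0; lra.
  by split; move: l r; rewrite (max_l (ltW y0)) expr0n/=; lra.
- by split; move: l r; rewrite (max_l (ltW y0)) sqrrB; lra.
Qed.

Section square_domain.
Context {d : measure_display} {R : realType} {X : borelMetricType d R}.
Context {m : {finite_measure set X -> \bar R}}.
Context {D : set (X -> R)} {E : (X -> R) -> (X -> R) -> R}.
Hypothesis E_dirichlet : dirichlet_form m D E.

(** With h = M / n the remainder in [square_approx] vanishes, so u^2 is within M^2 / n of a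
    combination of the functions (u - i h)^+. Its energy is at most (2 h)^2 n^2 times 6 energy u,
    that is 24 M^2 energy u, uniformly in n. *)
Lemma dom_sqr (M : R) (u : X -> R) : D u -> (forall x, 0 <= u x <= M) ->
  D (u \* u).
Proof.
move=> Du u0M.
have mX0 : 0 <= fine (m [set: X]) by exact/fine_ge0/measure_ge0.
have M0 : 0 <= M by have /andP[] := u0M point; exact: le_trans.
have mu := L2_measurable (dom_L2 E_dirichlet Du).
have L2uu : L2 m (u \* u).
  apply: (le_L2 _ _ (L2cst m (M ^+ 2))); first exact: measurable_funM.
  move=> x; have /andP[u0 uM] := u0M x.
  by rewrite /= !ger0_norm ?mulr_ge0 ?sqr_ge0// expr2 ler_pM.
have [|//] := bounded_energy_closed E_dirichlet
  (M := 24 * M ^+ 2 * energy E u) L2uu.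
move=> e e0; set mX := fine (m [set: X]) in mX0.
have C0 : 0 <= M ^+ 4 * mX by rewrite mulr_ge0// exprn_ge0.
(* The squared L^2 error is at most (M^2 / n)^2 m(X), hence at most M^4 m(X) / n; the summand 1
   keeps the divisor positive. *)
have [N _ /(_ N (leqnn N)) /= Ne] :
    \forall n \near \oo, n.+1%:R^-1 < e / (M ^+ 4 * mX + 1).
  by apply: (near_infty_natSinv_lt (PosNum (divr_gt0 e0 _))); lra.
set n := N.+1 in Ne; have n0 : 0 < n%:R :> R by [].
pose h := M / n%:R; have h0 : 0 <= h by rewrite divr_ge0// ltW.
have nh : n%:R * h = M by rewrite /h mulrC divfK// gt_eqF.
pose a i x := Num.max (u x - i%:R * h) 0.
have [||Ds Es] := @dom_sum _ _ _ _ _ _ E_dirichlet (6 * energy E u) n a.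
  by move=> i; apply: (dom_posB E_dirichlet _ Du).1; rewrite mulr_ge0.
  by move=> i; apply: (dom_posB E_dirichlet _ Du).2; rewrite mulr_ge0.
exists (fun x => 2 * h * \sum_(i < n) a i x); split.
- exact: (domZ E_dirichlet _ Ds).
- rewrite (energyZ E_dirichlet)//; apply: (le_trans (ler_wpM2l (sqr_ge0 _) Es)).
  rewrite le_eqVlt; apply/orP; left; apply/eqP; rewrite -nh; ring.
- have ah x : `|2 * h * (\sum_(i < n) a i x) - u x * u x| <= M ^+ 2 / n%:R.
    have /andP[ux0 uxM] := u0M x; have := square_approx n h0 ux0.
    rewrite nh (max_r (_ : u x - M <= 0)) ?subr_le0//.
    rewrite expr0n addr0 -mulr_sumr -!expr2 => /andP[l r].
    rewrite ger0_norm//; apply: (le_trans r); rewrite /h.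
    by rewrite le_eqVlt; apply/orP; left; apply/eqP; field; rewrite gt_eqF.
  apply: (@le_lt_trans _ _ (sqint m (cst (M ^+ 2 / n%:R)))).
    apply: le_sqint; first exact: L2cst.
      apply: L2B => //; apply: L2Z; exact: (dom_L2 E_dirichlet Ds).
    by move=> x; apply: (le_trans (ah x)); rewrite /= ler_norm.
  rewrite sqint_cst -/mX.
  rewrite ltr_pdivlMr in Ne; last by lra.
  apply: le_lt_trans Ne.
  have -> : (M ^+ 2 / n%:R) ^+ 2 * mX = n%:R^-1 * (n%:R^-1 * (M ^+ 4 * mX)).
    by field; rewrite gt_eqF.
  rewrite ler_wpM2l ?invr_ge0//.
  have : n%:R^-1 * (M ^+ 4 * mX) <= 1 * (M ^+ 4 * mX).
    by rewrite ler_wpM2r// invf_le1// ler1n.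
  by lra.
Qed.

End square_domain.

Section carre_du_champ.
Context {d : measure_display} {R : realType} {X : borelMetricType d R}.
Context {m : {finite_measure set X -> \bar R}}.
Context {D : set (X -> R)} {E : (X -> R) -> (X -> R) -> R}.
Context {G : (X -> R) -> (X -> R) -> X -> R}.
Hypothesis E_dirichlet : dirichlet_form m D E.
Hypothesis E_local : strongly_local m D E.
Hypothesis G_cdc : carre_du_champ m D E G.
Implicit Types (u v w : X -> R).

Lemma cdc_integrable u v : D u -> D v ->
  m.-integrable [set: X] (EFin \o G u v).
Proof. by move=> Du Dv; apply/Lfun1_integrable/(cdc_L1 G_cdc). Qed.

Lemma cdc_measurable u v : D u -> D v -> measurable_fun [set: X] (G u v).
Proof.
by move=> Du Dv; have /integrableP[/measurable_EFinP] := cdc_integrable Du Dv.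
Qed.

Lemma cdc_integral u : D u -> (\int[m]_x G u u x)%R = 2 * energy E u.
Proof.
by move=> Du; rewrite /energy (cdc_energy G_cdc E_local Du Du) mulrA mulfV ?mul1r.
Qed.

Lemma cdc_quad a u v : D u -> D v -> \forall x \ae m,
  G (a \*o u \+ v) (a \*o u \+ v) x =
    a ^+ 2 * G u u x + 2 * a * G u v x + G v v x.
Proof.
move=> Du Dv; have Dw := df_dom_lin E_dirichlet a Du Dv.
pose w := a \*o u \+ v.
have hl z : D z -> \forall x \ae m, G w z x = a * G u z x + G v z x.
  by move=> Dz; apply/ae_eqW; exact: cdc_lin G_cdc _ _ _ _ Du Dv Dz.
have hs z : D z -> \forall x \ae m, G z w x = G w z x.
  by move=> Dz; apply/ae_eqW; exact: (cdc_sym G_cdc Dz Dw).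
have hvu : \forall x \ae m, G v u x = G u v x.
  by apply/ae_eqW; exact: (cdc_sym G_cdc Dv Du).
have H := ae_and (hl _ Dw) (ae_and (hl _ Du) (ae_and (hl _ Dv)
  (ae_and (hs _ Du) (ae_and (hs _ Dv) hvu)))).
rewrite -/w; apply: filterS H => x [-> [e1 [e2 [-> [-> e3]]]]].
by rewrite e1 e2 e3; ring.
Qed.

Lemma cdc_quad_ge0 a u v : D u -> D v -> \forall x \ae m,
  0 <= a ^+ 2 * G u u x + 2 * a * G u v x + G v v x.
Proof.
move=> Du Dv; have Dw := df_dom_lin E_dirichlet a Du Dv.
by apply: filterS2 (cdc_quad a Du Dv) (cdc_ge0 G_cdc Dw) => x <-.
Qed.

(* Cauchy-Schwarz in the degenerate case. *)
Lemma cdc_null u v : D u -> D v ->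
  \forall x \ae m, G u u x = 0 -> G u v x = 0.
Proof.
move=> Du Dv.
(* The exceptional null set depends on the coefficient, so only countably many coefficients, the
   integers n and -n, are used. *)
have hp : \forall x \ae m, forall n : nat,
    0 <= n%:R ^+ 2 * G u u x + 2 * n%:R * G u v x + G v v x.
  by apply: ae_foralln => n; exact: cdc_quad_ge0.
have hn : \forall x \ae m, forall n : nat,
    0 <= (- n%:R) ^+ 2 * G u u x + 2 * (- n%:R) * G u v x + G v v x.
  by apply: ae_foralln => n; exact: cdc_quad_ge0.
apply: filterS2 hp hn => x hp hn Gu0; apply/eqP; apply: contrapT => /negP Guv.
(* For this n the linear term outweighs G v v x, and one of the signs makes the quadratic expression
   negative. *)
pose n := (Num.truncn (G v v x / `|G u v x|)).+1.
have Guv0 : 0 < `|G u v x| by rewrite normr_gt0.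
have : G v v x < n%:R * `|G u v x|.
  by rewrite -ltr_pdivrMr//; exact: truncnS_gt.
have := hp n; have := hn n; rewrite Gu0 !mulr0 !add0r.
have [g0|g0] := leP 0 (G u v x).
  have ng0 : 0 <= n%:R * G u v x by rewrite mulr_ge0.
  by rewrite (ger0_norm g0) !mulrN !mulNr -!mulrA; lra.
have ng0 : 0 <= n%:R * - G u v x by rewrite mulr_ge0// oppr_ge0 ltW.
by move: ng0; rewrite (ltr0_norm g0) !mulrN !mulNr -!mulrA; lra.
Qed.

(** Where G u u vanishes so does the mixed term, by [cdc_null]. With [cdcB_null], this later
    transfers the locality of positive parts to maxima and minima. *)
Lemma cdcD_null u v : D u -> D v -> \forall x \ae m,
  G u u x = 0 -> G (u \+ v) (u \+ v) x = G v v x.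
Proof.
move=> Du Dv; have -> : u \+ v = 1 \*o u \+ v.
  by apply/funext => x /=; rewrite mul1r.
apply: filterS2 (cdc_quad 1 Du Dv) (cdc_null Du Dv) => x -> + Gu0.
by move=> /(_ Gu0) ->; rewrite Gu0; ring.
Qed.

Lemma cdcB_null u v : D u -> D v -> \forall x \ae m,
  G u u x = 0 -> G (v \- u) (v \- u) x = G v v x.
Proof.
move=> Du Dv; have -> : v \- u = (-1) \*o u \+ v.
  by apply/funext => x /=; rewrite mulN1r addrC.
apply: filterS2 (cdc_quad (-1) Du Dv) (cdc_null Du Dv) => x -> + Gu0.
by move=> /(_ Gu0) ->; rewrite Gu0; ring.
Qed.

Lemma cdcZ a u : D u -> \forall x \ae m,
  G (fun x => a * u x) (fun x => a * u x) x = a ^+ 2 * G u u x.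
Proof.
move=> Du; have D0 := df_dom0 E_dirichlet.
have -> : (fun x => a * u x) = a \*o u \+ cst 0.
  by apply/funext => x /=; rewrite addr0.
(* Since 1 * 0 + 0 is again the zero function, [h1] says that its carre du champ is four times
   itself, hence zero. *)
have h0 := cdc_quad 0 Du D0; have h1 := cdc_quad 1 D0 D0.
have h2 := cdc_quad a Du D0.
have z0 : 1 \*o cst 0 \+ cst 0 = cst 0 :> (X -> R).
  by apply/funext => x /=; rewrite mul1r addr0.
rewrite z0 in h1.
have h3 : \forall x \ae m, G (cst 0) (cst 0) x = 0.
  by apply: filterS h1 => x; lra.
have /ae_eqW h4 := cdc_sym G_cdc Du D0.
apply: filterS2 h2 (ae_and h3 (ae_and h4 (cdc_null D0 Du))) => x -> [e3 [e4 e5]].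
by rewrite e4 e3 (e5 e3); ring.
Qed.

Lemma cdcB_le u v : D u -> D v -> \forall x \ae m,
  G (u \- v) (u \- v) x <= 2 * G u u x + 2 * G v v x.
Proof.
move=> Du Dv; have -> : u \- v = (-1) \*o v \+ u.
  by apply/funext => x /=; rewrite mulN1r addrC.
apply: filterS2 (cdc_quad (-1) Dv Du) (cdc_quad_ge0 1 Dv Du) => x ->.
by rewrite sqrrN !expr1n; lra.
Qed.

(** The constraint on N is stable under midpoints by [cdcD_null], so [energy_mazur] yields such
    functions a with a - u of small energy. On N, Gamma(u) is at most 2 Gamma(a - u), whose integral
    is 4 times that energy. *)
Lemma cdc_null_closed (N : set X) (M : R) u : measurable N -> L2 m u ->
  (forall e, 0 < e -> exists a, [/\ D a, energy E a <= M,
    \forall x \ae m, N x -> G a a x = 0 & sqint m (a \- u) < e]) ->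
  D u /\ \forall x \ae m, N x -> G u u x = 0.
Proof.
move=> mN Lu Mu.
pose P := [set a | [/\ D a, energy E a <= M & \forall x \ae m, N x -> G a a x = 0]].
have [|||//||Du Mazur] := @energy_mazur _ _ _ _ _ _ E_dirichlet P M u.
- by move=> a [].
- move=> a b [Da aM aN] [Db bM bN]; split; first exact: (dom_midpoint E_dirichlet).
    have := energy_ge0 E_dirichlet (domB E_dirichlet Da Db).
    by rewrite (energy_midpoint E_dirichlet)//; lra.
  have h := cdcZ 2^-1 (domD E_dirichlet Da Db).
  apply: filterS3 (ae_and h (cdcD_null Da Db)) aN bN => x [-> h'] aN bN Nx.
  by rewrite h' ?aN ?bN ?mulr0.
- by move=> a [].
- by move=> e /Mu[a [Da aM aN au]]; exists a.
split => //.
pose f x := G u u x * \1_N x.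
have iG v : D v -> m.-integrable [set: X] (EFin \o G v v).
  by move=> Dv; exact: cdc_integrable.
have i_f : m.-integrable [set: X] (EFin \o f).
  apply: (le_integrable _ _ _ (iG _ Du)) => //.
    apply/measurable_EFinP; apply: measurable_funM; first exact: cdc_measurable.
    exact: measurable_indic.
  move=> x _; rewrite /= lee_fin /f indicE normrM.
  by case: (x \in N); rewrite ?normr1 ?mulr1// normr0 mulr0.
have f_ge0 : \forall x \ae m, 0 <= f x.
  by apply: filterS (cdc_ge0 G_cdc Du) => x Gx; rewrite /f mulr_ge0// indicE.
suff f_le0 : (\int[m]_x f x <= 0)%R.
  have := ge0_Rintegral_eq0_ae i_f f_ge0 f_le0; apply: filterS => x + Nx.
  by rewrite /f indicE mem_set// mulr1.
apply/ler_addgt0Pr => e e0; rewrite add0r.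
have e4 : 0 < e / 4 by rewrite divr_gt0.
have [a [Da aM aN] au] := Mazur _ e4.
have Dau := domB E_dirichlet Da Du.
have uE : u = a \- (a \- u) by apply/funext => x /=; ring.
have := cdcB_le Da Dau; rewrite -uE => fle.
apply: (@le_trans _ _ (\int[m]_x (2 * G (a \- u) (a \- u) x))%R).
  apply: ae_le_Rintegral => //.
    exact: (integrableZl measurableT 2 (iG _ Dau)).
  apply: filterS3 aN fle (cdc_ge0 G_cdc Dau) => x aN le g0.
  rewrite /f indicE; case: (boolP (x \in N)) => [/set_mem Nx|_].
    by rewrite mulr1; move: le; rewrite (aN Nx) mulr0 add0r.
  by rewrite mulr0 mulr_ge0.
by rewrite RintegralZl ?cdc_integral//; [lra|exact: iG].
Qed.

End carre_du_champ.

(** * Locality *)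

Section continuous_functions.
Context {d : measure_display} {R : realType} {X : borelMetricType d R}.
Implicit Types (U V : set X) (u v : X -> R).

Lemma open_borel U : open U -> measurable U.
Proof. by move=> oU; rewrite borel_measurableE; exact: sub_sigma_algebra. Qed.

Lemma closed_borel U : closed U -> measurable U.
Proof.
by move=> cU; rewrite -(setCK U); apply/measurableC/open_borel/closed_openC.
Qed.

Lemma continuous_open_lt u (c : R) : continuous u -> open [set x | u x < c].
Proof.
move=> cu; rewrite (_ : [set _ | _] = u @^-1` [set y | y < c])//.
by apply: open_comp; [move=> x _; exact: cu|exact: open_lt].
Qed.

Lemma continuous_open_gt u (c : R) : continuous u -> open [set x | c < u x].
Proof.
move=> cu; rewrite (_ : [set _ | _] = u @^-1` [set y | c < y])//.
by apply: open_comp; [move=> x _; exact: cu|exact: open_gt].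
Qed.

Lemma continuous_bounded u (C : set X) : continuous u -> compact C ->
  exists M, forall x, C x -> `|u x| <= M.
Proof.
move=> cu cC.
have cuC : compact (u @` C).
  by apply: continuous_compact => //; exact: continuous_subspaceT.
have [M [_ uM]] := @compact_bounded R R^o _ cuC.
exists (M + 1) => x Cx; apply: (uM (M + 1)); first by rewrite ltrDl.
by exists x.
Qed.

Lemma mdist_continuous (x : X) : continuous (mdist x : X -> R).
Proof.
move=> y; apply/cvgrPdist_lt => e e0; near=> z.
have : ball y e z by near: z; exact: nbhsx_ballx.
rewrite ballEmdist/= => yz.
have := metric_triangle x y z; have := metric_triangle x z y.
rewrite (metric_sym z y) ltr_norml; lra.
Unshelve. all: by end_near. Qed.

(** The bump is (3 - 6 dist / r)^+, at least 2 within distance r/6 of x and zero from distance r/2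
    on. These heights leave room for the uniform error 1/2 in [dom_bump]. *)
Lemma locally_compact_bump (O : set X) (x : X) : locally_compact [set: X] ->
  open O -> O x -> exists (C V : set X) (f : X -> R),
  [/\ compact C, C `<=` O, open V /\ V x, continuous f &
   [/\ forall y, 0 <= f y <= 3, forall y, V y -> 2 <= f y &
    closure [set y | f y != 0] `<=` C]].
Proof.
move=> lcX oO Ox; have [K] := lcX x I.
rewrite /within /= => /(filterS (fun y h => h I)) Kx [cK clK].
have : nbhs x (O `&` K) by apply: filterI => //; exact: open_nbhs_nbhs.
rewrite -nbhs_ballE => -[r /= r0 rOK].
have cdist : continuous (mdist x : X -> R) := @mdist_continuous x.
pose f y : R := Num.max (3 - 6 / r * mdist x y) 0.
have r20 : 0 < r / 2 by rewrite divr_gt0.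
have clC : closed [set y | mdist x y <= r / 2].
  rewrite (_ : [set _ | _] = ~` [set y | r / 2 < mdist x y]).
    by apply: open_closedC; exact: continuous_open_gt.
  by apply/seteqP; split => y /=; [move=> h; apply/negP; rewrite -leNgt|
    move/negP; rewrite -leNgt].
have CrOK : [set y | mdist x y <= r / 2] `<=` O `&` K.
  move=> y /= xy; apply: rOK; rewrite ballEmdist /=.
  by apply: le_lt_trans xy _; lra.
exists [set y | mdist x y <= r / 2], [set y | mdist x y < r / 6], f; split.
- by apply: (subclosed_compact clC cK) => y /CrOK[].
- by move=> y /CrOK[].
- split; first exact: continuous_open_lt.
  by rewrite /= mdistxx divr_gt0.
- move=> y; apply: (@continuous_max R X (fun y => 3 - 6 / r * mdist x y) (cst 0)).
    apply: (@cvgB _ R^o); first exact: cvg_cst.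
    by apply: (@cvgMr _ _); exact: cdist.
  exact: cvg_cst.
split.
- move=> y; rewrite /f le_max lexx orbT ge_max /=.
  have := mulr_ge0 (ltW (divr_gt0 (ltr0n R 6) r0)) (mdist_ge0 x y); lra.
- move=> y /= xy; rewrite /f le_max; apply/orP; left.
  rewrite lerBrDr -lerBrDl (_ : 3 - 2 = 1); last by ring.
  by rewrite mulrAC ler_pdivrMr// mul1r; lra.
- apply: (subset_trans _ (_ : closure [set y | mdist x y <= r / 2] `<=` _)); last first.
    by rewrite -(closure_id _).1.
  apply: closureS => y /=; apply: contraNle => xy.
  rewrite /f max_r// subr_le0 mulrAC ler_pdivlMr//; lra.
Qed.

End continuous_functions.

Section essential_supports.
Context {d : measure_display} {R : realType} {X : borelMetricType d R}.
Context {m : {finite_measure set X -> \bar R}}.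
Implicit Types (u : X -> R).

Lemma closed_essential_support u : closed (essential_support m u).
Proof.
rewrite -(setCK (essential_support m u)); apply: open_closedC.
rewrite openE => x /= /existsNP[U /not_implyP[oU /not_implyP[Ux /contrapT U0]]].
rewrite /interior; apply: filterS (open_nbhs_nbhs (conj oU Ux)) => y Uy.
by move=> /(_ U oU Uy).
Qed.

Lemma essential_support_sub u (C : set X) : closed C ->
  (forall x, ~ C x -> u x = 0) -> essential_support m u `<=` C.
Proof.
move=> clC u0 x ux; apply: contrapT => nCx.
apply: (ux (~` C)) => //; first exact: closed_openC.
by apply: aeW => y; exact: u0.
Qed.

Lemma compact_essential_support u (C : set X) : compact C ->
  (forall x, ~ C x -> u x = 0) -> compact (essential_support m u).
Proof.
move=> cC u0; apply: (@subclosed_compact _ _ C) => //.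
  exact: closed_essential_support.
apply: essential_support_sub => //; apply: compact_closed => //.
exact: metric_hausdorff.
Qed.

End essential_supports.

Section locality.
Context {d : measure_display} {R : realType} {X : borelMetricType d R}.
Context {m : {finite_measure set X -> \bar R}}.
Context {D : set (X -> R)} {E : (X -> R) -> (X -> R) -> R}.
Context {G : (X -> R) -> (X -> R) -> X -> R}.
Hypothesis lcX : locally_compact [set: X].
Hypothesis radon_m : radon m.
Hypothesis E_dirichlet : dirichlet_form m D E.
Hypothesis E_regular : regular_form m D E.
Hypothesis E_local : strongly_local m D E.
Hypothesis G_cdc : carre_du_champ m D E G.
Implicit Types (u v w f h : X -> R).

(** A function w of the domain within 1/2 of a continuous bump need not vanish off C, but (w -
    1/2)^+ does, and it is still at least 1 where the bump is at least 2. *)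
Lemma dom_bump (O : set X) x : open O -> O x ->
  exists C V f, [/\ compact C, C `<=` O, open V /\ V x, D f &
   [/\ forall y, 0 <= f y <= 4, forall y, V y -> 1 <= f y &
    forall y, ~ C y -> f y = 0]].
Proof.
move=> oO Ox.
have [C [V [g [cC CO oVx cg [g03 gV gC]]]]] := locally_compact_bump lcX oO Ox.
have Ccg : Cc g.
  split => //; apply: subclosed_compact gC => //; exact: closed_closure.
have e0 : 0 < 2^-1 :> R by [].
have [w [Dw _] gw] := rf_dense_Cc E_regular Ccg e0.
exists C, V, (fun y => Num.max (w y - 2^-1) 0); split => //.
  by apply: (dom_posB E_dirichlet _ Dw).1; exact: ltW.
have gw' y : - 2^-1 < g y - w y < 2^-1 by rewrite -ltr_norml.
split.
- move=> y; rewrite le_max lexx orbT ge_max /=.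
  by have := gw' y; have := g03 y; lra.
- move=> y /gV gy; rewrite le_max; apply/orP; left.
  by have := gw' y; lra.
- move=> y nCy; have gy : g y = 0.
    by apply: contrapT => /eqP gy; apply/nCy/gC/subset_closure.
  by rewrite max_r//; have := gw' y; rewrite gy; lra.
Qed.

(* The product formula for a bump f supported in O gives
   int f Gamma(h) = 2 E(h f, h) - E(h^2, f), where h f = 0 and E(h^2, f) = 0 by
   strong locality. *)
Lemma cdc_open_zero (O C : set X) (M : R) h : open O -> compact C -> D h ->
  (forall x, 0 <= h x <= M) -> (forall x, ~ C x -> h x = 0) ->
  (forall x, O x -> h x = 0) -> \forall x \ae m, O x -> G h h x = 0.
Proof.
move=> oO cC Dh h0M hC hO.
have mh := L2_measurable (dom_L2 E_dirichlet Dh).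
have Dhh := dom_sqr E_dirichlet Dh h0M.
have mGh := cdc_measurable G_cdc Dh Dh.
have Gh0 := cdc_ge0 G_cdc Dh.
have loc x : O x -> exists2 V, open V /\ V x & \forall y \ae m, V y -> G h h y = 0.
  move=> Ox; have [C' [V [f [cC' C'O oVx Df [f04 fV fC']]]]] := dom_bump oO Ox.
  exists V => //.
  have mf := L2_measurable (dom_L2 E_dirichlet Df).
  have fh : E (h \* h) f = 0.
    rewrite (df_form_sym E_dirichlet Dhh Df); apply: E_local => //.
    - exact: compact_essential_support fC'.
    - by apply: (compact_essential_support cC) => y /hC /= ->; rewrite mul0r.
    - exists O, 0; split => //.
        apply: subset_trans C'O; apply: essential_support_sub => //.
        by apply: compact_closed => //; exact: metric_hausdorff.
      by apply: aeW => y /hO /= ->; rewrite mul0r.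
  have hf0 : h \* f = cst 0.
    apply/funext => y /=; have [Oy|nOy] := pselect (O y); first by rewrite hO ?mul0r.
    by rewrite fC' ?mulr0// => /C'O.
  have hb : h \in Lfun m +oo%E.
    by apply: (@bounded_Lfun _ _ _ _ M) => // y;
      have /andP[h0 hM] := h0M y; rewrite ger0_norm.
  have fb : f \in Lfun m +oo%E.
    by apply: (@bounded_Lfun _ _ _ _ 4) => // y;
      have /andP[f0 fM] := f04 y; rewrite ger0_norm.
  have := cdc_product G_cdc Dh Dh Df hb hb fb.
  rewrite fh hf0 (form0l E_dirichlet)// addr0 subr0 => int0.
  have iG := cdc_integrable G_cdc Dh Dh.
  have ifG : m.-integrable [set: X] (EFin \o (fun y => f y * G h h y)).
    apply: (le_integrable _ _ _ (integrableZl measurableT 4 iG)) => //.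
      by apply/measurable_EFinP; exact: measurable_funM.
    move=> y _; rewrite /= lee_fin !normrM ler_wpM2r//.
    by have /andP[f0 f4] := f04 y; rewrite ger0_norm// (ger0_norm (_ : 0 <= 4)).
  have ge0 : \forall y \ae m, 0 <= f y * G h h y.
    by apply: filterS Gh0 => y Gy; have /andP[f0 f4] := f04 y; rewrite mulr_ge0.
  have := ge0_Rintegral_eq0_ae ifG ge0; rewrite -int0 lexx => /(_ isT).
  apply: filterS => y /eqP + Vy; rewrite mulf_eq0 => /orP[/eqP fy0|/eqP//].
  by have := fV _ Vy; rewrite fy0 ler10.
(* The local statements are globalized by inner regularity: it suffices that compact subsets of the
   intersection of O and N are null. *)
pose N := [set x | G h h x != 0].
have mN : measurable N.
  rewrite (_ : N = G h h @^-1` (~` [set 0])).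
    by rewrite -[X in measurable X]setTI; apply: mGh => //; exact: measurableC.
  by apply/seteqP; split => x /= /eqP.
have mON : measurable (O `&` N) by apply: measurableI => //; exact: open_borel.
have mON0 : m (O `&` N) = 0%E.
  rewrite radon_m//; apply/eqP; rewrite eq_le; apply/andP; split; last first.
    apply: ereal_sup_ubound; exists set0; last exact: measure0.
    by split => //; exact: compact0.
  apply: ge_ereal_sup => _ [K [cK KON] <-].
  (* Compactness is used as near covering along the a.e. filter: the statements on a finite cover of
     K combine into one. The equation x = y ties the point of K to the point at which the a.e.
     property is read. *)
  have : \forall y \ae m, K `<=` (fun x => x = y -> G h h y = 0).
    have /compact_near_coveringP := cK.
    move=> /(_ X (almost_everywhere m) (fun y x => x = y -> G h h y = 0)); apply.
    move=> x /KON[/loc[V [oV Vx] V0] _].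
    exists (V, [set y | V y -> G h h y = 0]).
      by split => //=; exact: open_nbhs_nbhs.
    by move=> -[x' y] /= [Vx' Vy] xy; apply: Vy; rewrite -xy.
  move=> [A [mA A0 KA]]; rewrite -A0; apply: le_measure; rewrite ?inE//.
    apply: closed_borel; apply: compact_closed => //; exact: metric_hausdorff.
  move=> y Ky; apply: KA => /= /(_ y Ky erefl).
  by have [_ /eqP] := KON y Ky.
exists (O `&` N); split => // x /= /not_implyP[Ox Gx]; split => //.
exact/eqP.
Qed.

(* The positive part of w is approximated by (min w g - e)^+ with g in Cc close
   to w, which is compactly supported and vanishes on the open set [w < e]. *)
Lemma cdc_pos_zero w : D w -> continuous w ->
  \forall x \ae m, w x <= 0 ->
    G (fun y => Num.max (w y) 0) (fun y => Num.max (w y) 0) x = 0.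
Proof.
move=> Dw cw; pose wp y := Num.max (w y) 0.
have [Dwp _] := dom_pos E_dirichlet Dw.
have mN : measurable [set x | w x <= 0].
  rewrite (_ : [set _ | _] = ~` [set x | 0 < w x]).
    by apply: measurableC; apply: open_borel; exact: continuous_open_gt.
  by apply/seteqP; split => y /=; [move=> h; apply/negP; rewrite -leNgt|
    move/negP; rewrite -leNgt].
(* The approximant is (y - t)^+ with y = w - (w - g)^+. The energy of (w - g)^+ is below 2, so that
   of y is below 2 energy w + 4, and [dom_posB] multiplies this by 6. *)
have [|_ //] := @cdc_null_closed _ _ _ _ _ _ _ E_dirichlet E_local G_cdc
  [set x | w x <= 0] (12 * energy E w + 24) wp mN (dom_L2 E_dirichlet Dwp).
move=> e e0; set mX := fine (m [set: X]).
have mX0 : 0 <= mX by exact/fine_ge0/measure_ge0.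
(* The final error is at most 2 t^2 m(X) + 2 sqint (w - g), hence at most t (2 m(X) + 2), since t is
   at most 1 and g is chosen within t of w for [form1]. *)
pose t : R := Num.min 1 (e / 2 / (2 * mX + 2)).
have t0 : 0 < t by rewrite lt_min ltr01 !divr_gt0//; lra.
have t1 : t <= 1 by rewrite ge_min lexx.
have te : t * (2 * mX + 2) <= e / 2.
  by rewrite -ler_pdivlMr ?ge_min ?lexx ?orbT//; lra.
have [g [Dg [cg cCg]] wg] := rf_dense_dom E_regular Dw t0.
rewrite form1E in wg.
have Dwg := domB E_dirichlet Dw Dg.
have eg0 := energy_ge0 E_dirichlet Dwg; have sg0 := sqint_ge0 m (w \- g).
have [Dp Ep] := dom_pos E_dirichlet Dwg.
pose y := w \- (fun x => Num.max ((w \- g) x) 0).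
have yE x : y x = Num.min (w x) (g x).
  rewrite /y /=; have [h|h] := leP (w x) (g x).
    by rewrite max_r ?subr0// subr_le0.
  by rewrite max_l ?opprB ?subrKC// subr_ge0 ltW.
have Dy : D y by exact: (domB E_dirichlet).
have [Dh Eh] := dom_posB E_dirichlet (ltW t0) Dy.
exists (fun x => Num.max (y x - t) 0); split => //.
- have := energyB_le E_dirichlet Dw Dp; rewrite -/y; lra.
- have [M gM] := continuous_bounded cg cCg.
  have : \forall x \ae m, [set x | w x < t] x ->
      G (fun x => Num.max (y x - t) 0) (fun x => Num.max (y x - t) 0) x = 0.
    have gy0 x : ~ closure [set x | g x != 0] x -> g x = 0.
      by move=> h; apply: contrapT => /eqP gx; apply: h; exact: subset_closure.
    (* The maximum with 0 keeps the bound nonnegative: M bounds g only on the closed support, which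
       may be empty. *)
    apply: (@cdc_open_zero _ (closure [set x | g x != 0]) (Num.max M 0)) => //.
    + exact: continuous_open_lt.
    + move=> x; rewrite le_max lexx orbT /= ge_max; apply/andP; split; last first.
        by rewrite le_max lexx orbT.
      apply: (@le_trans _ _ (g x)).
        have : y x <= g x by rewrite yE ge_min lexx orbT.
        by lra.
      have [gx|/gy0 ->] := pselect (closure [set x | g x != 0] x).
        by rewrite le_max (le_trans (ler_norm _) (gM _ gx)).
      by rewrite le_max lexx orbT.
    + by move=> x /gy0 gx; rewrite max_r// subr_le0 yE gx ge_min (ltW t0) orbT.
    + by move=> x /= wx; rewrite max_r// subr_le0 yE ge_min (ltW wx).
  by apply: filterS => x + wx; apply => /=; exact: le_lt_trans wx t0.
- have Lt := L2cst m t.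
  have Lwg := dom_L2 E_dirichlet Dwg.
  have mwg : measurable_fun [set: X] (Num.norm \o (w \- g)).
    by apply: measurableT_comp => //; exact: L2_measurable Lwg.
  have Lnwg : L2 m (Num.norm \o (w \- g)).
    by apply: (le_L2 mwg _ Lwg) => x /=; rewrite normr_id.
  apply: (@le_lt_trans _ _ (sqint m (cst t \+ (Num.norm \o (w \- g))))).
    apply: le_sqint; first exact: L2D.
      apply: L2B; first exact: (dom_L2 E_dirichlet Dh).
      exact: (dom_L2 E_dirichlet Dwp).
    move=> x /=; rewrite [X in _ <= X]ger0_norm; last by rewrite addr_ge0// ltW.
    rewrite yE /wp ler_norml.
    have := ler_norm (w x - g x); have := ler_norm (- (w x - g x)); rewrite normrN.
    have [wgx|wgx] := leP (w x) (g x);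
      [case: (leP (w x - t) 0)|case: (leP (g x - t) 0)];
      case: (leP (w x) 0) => *; apply/andP; split; lra.
  have le2 : sqint m (Num.norm \o (w \- g)) <= sqint m (w \- g).
    by apply: le_sqint => // x /=; rewrite normr_id.
  apply: (le_lt_trans (sqintD_le Lt Lnwg)); rewrite sqint_cst -/mX.
  have tt : t ^+ 2 * mX <= t * mX.
    by rewrite ler_wpM2r// expr2 ler_piMl// ltW.
  lra.
Qed.

End locality.

(** * Capacity *)

Section capacity_properties.
Context {d : measure_display} {R : realType} {X : borelMetricType d R}.
Context {m : {finite_measure set X -> \bar R}}.
Context {D : set (X -> R)} {E : (X -> R) -> (X -> R) -> R}.
Context {G : (X -> R) -> (X -> R) -> X -> R}.
Hypothesis lcX : locally_compact [set: X].
Hypothesis radon_m : radon m.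
Hypothesis E_dirichlet : dirichlet_form m D E.
Hypothesis E_regular : regular_form m D E.
Hypothesis E_local : strongly_local m D E.
Hypothesis G_cdc : carre_du_champ m D E G.
Hypothesis E_coercive : coercive m D E.
Context {p : R}.
Hypothesis p_gt2 : 2 < p.
Implicit Types (u v w : X -> R) (K L : set X).

Lemma maxE_addpos u v : u \max v = (fun x => Num.max ((u \- v) x) 0) \+ v.
Proof.
apply/funext => x /=; have [h|h] := leP (u x) (v x).
  by rewrite max_r ?add0r// subr_le0.
by rewrite max_l ?subrK// subr_ge0 ltW.
Qed.

Lemma minE_subpos u v : u \min v = u \- (fun x => Num.max ((u \- v) x) 0).
Proof.
apply/funext => x /=; have [h|h] := leP (u x) (v x).
  by rewrite max_r ?subr0// subr_le0.
by rewrite max_l ?opprB ?subrKC// subr_ge0 ltW.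
Qed.

Lemma dom_max u v : D u -> D v -> D (u \max v).
Proof.
move=> Du Dv; rewrite maxE_addpos; apply: (domD E_dirichlet) => //.
exact: (dom_pos E_dirichlet (domB E_dirichlet Du Dv)).1.
Qed.

Lemma dom_min u v : D u -> D v -> D (u \min v).
Proof.
move=> Du Dv; rewrite minE_subpos; apply: (domB E_dirichlet) => //.
exact: (dom_pos E_dirichlet (domB E_dirichlet Du Dv)).1.
Qed.

(** On [u <= v] the function (u - v)^+ has zero carre du champ by [cdc_pos_zero]. Adding it to v, or
    subtracting it from u, therefore changes neither Gamma(v) nor Gamma(u) there. *)
Lemma cdc_max_min u v : D u -> D v -> continuous u -> continuous v ->
  \forall x \ae m, u x <= v x ->
    G (u \max v) (u \max v) x = G v v x /\ G (u \min v) (u \min v) x = G u u x.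
Proof.
move=> Du Dv cu cv; have Duv := domB E_dirichlet Du Dv.
have Dw := (dom_pos E_dirichlet Duv).1.
rewrite maxE_addpos minE_subpos.
have cuv : continuous (u \- v) by move=> x; apply: cvgB; [exact: cu|exact: cv].
have h0 := cdc_pos_zero lcX radon_m E_dirichlet E_regular E_local G_cdc Duv cuv.
have h1 := cdcD_null E_dirichlet G_cdc Dw Dv.
have h2 := cdcB_null E_dirichlet G_cdc Dw Du.
apply: filterS3 h0 h1 h2 => x h0 h1 h2 uv; have {}h0 := h0 _.
by rewrite h1 ?h2// h0//= subr_le0.
Qed.

Let p_ge1 : 1 <= p. Proof. by move: p_gt2; lra. Qed.

Lemma measurable_sqrt_cdc u : D u ->
  measurable_fun [set: X] (fun x => Num.sqrt (G u u x)).
Proof.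
move=> Du; apply: (measurableT_comp _ (cdc_measurable G_cdc Du Du)).
apply: continuous_measurable_fun; exact: sqrt_continuous.
Qed.

Lemma dom_p_between u v z : dom_p m D G p u -> dom_p m D G p v -> D z ->
  (forall x, `|z x| <= `|u x| + `|v x|) ->
  (\forall x \ae m, G z z x = G u u x \/ G z z x = G v v x) ->
  dom_p m D G p z.
Proof.
move=> [Du Lu Gu] [Dv Lv Gv] Dz zuv Gz.
have Lnorm f : f \in Lfun m p%:E -> Num.norm \o f \in Lfun m p%:E.
  move=> Lf; apply: (le_Lfun p_ge1 _ _ Lf) => [|x] /=; last by rewrite normr_id.
  by apply: measurableT_comp => //; exact: Lfun_measurable Lf.
have mGz := measurable_sqrt_cdc Dz.
split => //.
  apply: (le_Lfun p_ge1 _ _ (LfunD p_ge1 (Lnorm _ Lu) (Lnorm _ Lv))).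
    exact: L2_measurable (dom_L2 E_dirichlet Dz).
  by move=> x /=; apply: le_trans (zuv x) (ler_norm _).
pose s x := Num.sqrt (G u u x) + Num.sqrt (G v v x).
have s0 x : 0 <= s x by rewrite addr_ge0.
(* The cut-off at [s] changes nothing a.e., but gives the pointwise domination required by
   [le_Lfun]. *)
pose k x := Num.min (Num.sqrt (G z z x)) (s x).
have Ls : s \in Lfun m p%:E by exact: LfunD.
apply: (@ae_Lfun _ _ _ _ _ k) => //.
  apply: filterS Gz => x Gz; rewrite /k min_l// /s.
  by case: Gz => ->; rewrite ?lerDl ?lerDr.
apply: (le_Lfun p_ge1 _ _ Ls) => [|x].
  by apply: measurable_minr => //; exact: Lfun_measurable Ls.
by rewrite !ger0_norm// ?ge_min ?lexx ?orbT// le_min sqrtr_ge0 s0.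
Qed.

Lemma dom_p_max_min u v : dom_p m D G p u -> dom_p m D G p v ->
  continuous u -> continuous v ->
  dom_p m D G p (u \max v) /\ dom_p m D G p (u \min v).
Proof.
move=> Wu Wv cu cv; have [Du _ _] := Wu; have [Dv _ _] := Wv.
have minC : v \min u = u \min v by apply/funext => x /=; rewrite minC.
have maxC : v \max u = u \max v by apply/funext => x /=; rewrite maxC.
have h1 := cdc_max_min Du Dv cu cv; have h2 := cdc_max_min Dv Du cv cu.
rewrite minC maxC in h2.
have n1 (x : X) : `|u x| <= `|u x| + `|v x| by rewrite lerDl.
have n2 (x : X) : `|v x| <= `|u x| + `|v x| by rewrite lerDr.
split; apply: (dom_p_between Wu Wv).
- exact: dom_max.
- by move=> x /=; case: (leP (u x) (v x)).
- apply: filterS2 h1 h2 => x h1 h2.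
  by have [/h1[->]|/ltW/h2[->]] := leP (u x) (v x); [right|left].
- exact: dom_min.
- by move=> x /=; case: (leP (u x) (v x)).
- apply: filterS2 h1 h2 => x h1 h2.
  by have [/h1[_ ->]|/ltW/h2[_ ->]] := leP (u x) (v x); [left|right].
Qed.

Definition energy_p u : \bar R := (\int[m]_x (G u u x `^ (p / 2))%:E)%E.

Lemma energy_p_ge0 u : (0 <= energy_p u)%E.
Proof. by apply: integral_ge0 => x _; rewrite lee_fin powR_ge0. Qed.

Lemma measurable_cdc_powR u : D u ->
  measurable_fun [set: X] (fun x => (G u u x `^ (p / 2))%:E).
Proof.
move=> Du; apply/measurable_EFinP.
exact: (measurableT_comp (measurable_powR _) (cdc_measurable G_cdc Du Du)).
Qed.

Lemma energy_p_max_min u v : D u -> D v -> continuous u -> continuous v ->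
  (energy_p (u \max v) + energy_p (u \min v) = energy_p u + energy_p v)%E.
Proof.
move=> Du Dv cu cv.
have DM := dom_max Du Dv; have Dm := dom_min Du Dv.
have minC : v \min u = u \min v by apply/funext => x /=; rewrite minC.
have maxC : v \max u = u \max v by apply/funext => x /=; rewrite maxC.
have h1 := cdc_max_min Du Dv cu cv; have h2 := cdc_max_min Dv Du cv cu.
rewrite minC maxC in h2.
have mG := measurable_cdc_powR.
have G0 u' x : (0 <= (G u' u' x `^ (p / 2))%:E)%E by rewrite lee_fin powR_ge0.
have iD u1 u2 : D u1 -> D u2 -> (energy_p u1 + energy_p u2 =
    \int[m]_x ((G u1 u1 x `^ (p / 2))%:E + (G u2 u2 x `^ (p / 2))%:E))%E.
  by move=> D1 D2; rewrite ge0_integralD//; exact: mG.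
rewrite (iD _ _ DM Dm) (iD _ _ Du Dv); apply: ge0_ae_eq_integral => //.
- by apply: emeasurable_funD; exact: mG.
- by apply: emeasurable_funD; exact: mG.
- by move=> x _; rewrite adde_ge0.
- by move=> x _; rewrite adde_ge0.
- apply: filterS2 h1 h2 => x h1 h2 _.
  have [/h1[-> ->]|/ltW/h2[-> ->]//] := leP (u x) (v x).
  by rewrite addeC.
Qed.

Lemma cap_compact_ge0 K : (0 <= cap_compact m D G p K)%E.
Proof. by apply: le_ereal_inf_tmp => _ [u _ <-]; exact: energy_p_ge0. Qed.

Lemma le_cap_compact K L : K `<=` L ->
  (cap_compact m D G p K <= cap_compact m D G p L)%E.
Proof.
move=> KL; apply: le_ereal_inf_tmp => _ [u [Wu cu u1] <-].
by apply: ereal_inf_lbound; exists u => //; split => // x /KL; exact: u1.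
Qed.

(** For test functions u of K and v of L, [u \max v] is a test function of the union and [u \min v]
    one of the intersection, with the same total p-energy by [energy_p_max_min]. *)
Lemma cap_compact_strong_subadd :
  strongly_subadditive_on_compacts (cap_compact m D G p).
Proof.
move=> K L _ _; apply: le_ereal_infD.
- by move=> _ [u _ <-]; exact: energy_p_ge0.
- by move=> _ [u _ <-]; exact: energy_p_ge0.
move=> _ _ [u [Wu cu u1] <-] [v [Wv cv v1] <-].
have [Du _ _] := Wu; have [Dv _ _] := Wv.
have [WM Wm] := dom_p_max_min Wu Wv cu cv.
have := energy_p_max_min Du Dv cu cv; rewrite /energy_p => <-.
apply: leeD; apply: ereal_inf_lbound.
  exists (u \max v) => //; split => //.
    by move=> x; apply: (@continuous_max R X u v); [exact: cu|exact: cv].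
  by move=> x [/u1|/v1] h /=; rewrite le_max h ?orbT.
exists (u \min v) => //; split => //.
  by move=> x; apply: (@continuous_min R X u v); [exact: cu|exact: cv].
by move=> x [/u1 h /v1 h'] /=; rewrite le_min h h'.
Qed.

(** For t > e, t equals t^q / t^(q - 1), and the divisor is at least e^(q - 1). It is used with q =
    p / 2, where p > 2 gives q > 1. *)
Lemma le_add_powR (q e t : R) : 1 < q -> 0 < e -> 0 <= t ->
  t <= e + (e `^ (q - 1))^-1 * t `^ q.
Proof.
move=> q1 e0 t0; have b0 : 0 < e `^ (q - 1) by exact: powR_gt0.
have [te|et] := leP t e.
  by apply: (le_trans te); rewrite lerDl mulr_ge0 ?invr_ge0 ?powR_ge0.
have tp : 0 < t by exact: lt_trans et.
apply: (@le_trans _ _ ((e `^ (q - 1))^-1 * t `^ q)); last by rewrite lerDr ltW.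
have -> : t `^ q = t `^ (q - 1) * t.
  by rewrite -[X in _ = _ * X](powRr1 t0) -powRD ?subrK// (gt_eqF tp) implybT.
rewrite ler_pdivlMl//; apply: ler_wpM2r => //.
by apply: ge0_ler_powR; rewrite ?nnegrE ?subr_ge0 ?(ltW q1) ?(ltW e0) ?(ltW et).
Qed.

Lemma Rintegral_cdc_le (e : R) u : 0 < e -> D u ->
  ((\int[m]_x G u u x)%:E <= (e * fine (m [set: X]))%:E
    + ((e `^ (p / 2 - 1))^-1)%:E * energy_p u)%E.
Proof.
move=> e0 Du; set b := _^-1.
have b0 : 0 <= b by rewrite invr_ge0 powR_ge0.
have mG := cdc_measurable G_cdc Du Du.
have mP : measurable_fun [set: X] (fun x => Num.max (G u u x) 0).
  by apply: measurable_maxr => //; exact: measurable_cst.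
have GP : \forall x \ae m, G u u x = Num.max (G u u x) 0.
  by apply: filterS (cdc_ge0 G_cdc Du) => x Gx; rewrite max_l.
have iG := cdc_integrable G_cdc Du Du.
rewrite (ae_eq_Rintegral iG mP GP) fineK; last first.
  apply: integrable_fin_num => //; exact: (ae_integrable mP GP iG).
have fX : m [set: X] \is a fin_num by exact: fin_num_measure.
rewrite EFinM fineK// -integral_cst// -ge0_integralZl//; last 2 first.
- exact: measurable_cdc_powR.
- by move=> x _; rewrite lee_fin powR_ge0.
rewrite -ge0_integralD//; last 3 first.
- by move=> x _; rewrite lee_fin ltW.
- by move=> x _; rewrite mule_ge0 ?lee_fin ?powR_ge0.
- by apply: measurable_funeM; exact: measurable_cdc_powR.
apply: ge0_le_integral => //.
- by move=> x _; rewrite lee_fin le_max lexx orbT.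
- exact/measurable_EFinP.
- by apply: emeasurable_funD => //; apply: measurable_funeM;
    exact: measurable_cdc_powR.
- move=> x _; rewrite -EFinM -EFinD lee_fin.
  have [G0|G0] := leP (G u u x) 0.
    by rewrite addr_ge0 ?mulr_ge0 ?powR_ge0// ltW.
  by apply: le_add_powR => //; [move: p_gt2; lra|exact: ltW].
Qed.

(** The constant c does not depend on e, whereas b does: e can be chosen to make e c small, and then
    t to make b t small. The factor k / 2 comes from energy w being half the integral of Gamma(w);
    the absolute value is taken because coercivity fixes no sign for k. *)
Lemma measure_le_cap_compact : exists2 c : R, 0 <= c & forall e : R, 0 < e ->
  exists2 b : R, 0 <= b & forall K (t : R), compact K ->
    (cap_compact m D G p K < t%:E)%E -> (m K <= (e * c + b * t)%:E)%E.
Proof.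
have [k hk] := E_coercive; pose c := `|k| / 2.
have c0 : 0 <= c by rewrite divr_ge0.
have mX0 : 0 <= fine (m [set: X]) by exact/fine_ge0/measure_ge0.
exists (c * fine (m [set: X])); first exact: mulr_ge0.
move=> e e0; pose a := (e `^ (p / 2 - 1))^-1.
have a0 : 0 <= a by rewrite invr_ge0 powR_ge0.
exists (c * a); first exact: mulr_ge0.
move=> K t cK /ereal_inf_lt[_ [w [[Dw _ _] cw w1] <-]] wt.
have mK : measurable K.
  by apply: closed_borel; apply: compact_closed => //; exact: metric_hausdorff.
have Lw := dom_L2 E_dirichlet Dw.
apply: (@le_trans _ _ (sqint m w)%:E).
  rewrite fineK; last exact: (integrable_fin_num _ (L2_integrable Lw)).
  rewrite -[X in m X]setIT -integral_indic//; apply: ge0_le_integral => //.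
  - have mi : measurable_fun [set: X] (\1_K : X -> R) by exact: measurable_indic.
    by have [_ /(_ mi)] := measurable_EFinP [set: X] (\1_K : X -> R).
  - by have /integrableP[] := L2_integrable Lw.
  - move=> x _; rewrite lee_fin indicE; case: (boolP (x \in K)) => [/set_mem/w1|_].
      by move=> ?; rewrite expr_ge1// (le_trans ler01).
    exact: sqr_ge0.
apply: (@le_trans _ _ (c * \int[m]_x G w w x)%:E).
  rewrite lee_fin (cdc_integral E_local G_cdc)//; apply: le_trans (hk _ Dw) _.
  rewrite /c mulrA divfK// ler_wpM2r ?ler_norm//.
  exact: (energy_ge0 E_dirichlet Dw).
have := Rintegral_cdc_le e0 Dw; rewrite -/a => h.
have {h} : (\int[m]_x G w w x <= e * fine (m [set: X]) + a * t)%R.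
  rewrite -lee_fin; apply: (le_trans h); rewrite EFinD leeD2l// EFinM.
  by apply: lee_wpmul2l; rewrite ?lee_fin// ltW.
move=> /(ler_wpM2l c0); rewrite lee_fin => /le_trans; apply.
by rewrite le_eqVlt; apply/orP; left; apply/eqP; ring.
Qed.

Lemma cap_eq0_negligible (A : set X) : cap m D G p A = 0%E -> m.-negligible A.
Proof.
move=> A0; have [c c0 hc] := measure_le_cap_compact.
have UA n : exists U, [/\ open U, A `<=` U & (m U <= (n.+1%:R^-1)%:E)%E].
  set r := n.+1%:R^-1; have r0 : 0 < r :> R by rewrite invr_gt0.
  (* These choices make each of e c and b t at most r / 2; the summands 1 avoid division by zero. *)
  have e0 : 0 < r / 2 / (c + 1) by rewrite !divr_gt0//; lra.
  have [b b0 hb] := hc _ e0.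
  have t0 : 0 < r / 2 / (b + 1) by rewrite !divr_gt0//; lra.
  have : (cap m D G p A < (r / 2 / (b + 1))%:E)%E by rewrite A0 lte_fin.
  move=> /ereal_inf_lt[_ [U [oU AU] <-]] Ut; exists U; split => //.
  rewrite radon_m; last exact: open_borel.
  apply: ge_ereal_sup => _ [K [cK KU] <-].
  have : (cap_compact m D G p K < (r / 2 / (b + 1))%:E)%E.
    by apply: le_lt_trans Ut; apply: ereal_sup_ubound; exists K.
  move=> /(hb _ _ cK) /le_trans; apply; rewrite lee_fin.
  have h1 : r / 2 / (c + 1) * c <= r / 2.
    by rewrite mulrAC ler_pdivrMr; [rewrite ler_wpM2l//; lra|lra].
  have h2 : b * (r / 2 / (b + 1)) <= r / 2.
    by rewrite mulrC mulrAC ler_pdivrMr; [rewrite ler_wpM2l//; lra|lra].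
  lra.
have [U hU] := choice UA.
have mU n : measurable (U n) by apply: open_borel; case: (hU n).
have mI : measurable (\bigcap_n U n) by exact: bigcapT_measurable.
exists (\bigcap_n U n); split => //; last first.
  by move=> x Ax n _; case: (hU n) => _ + _; exact.
apply/eqP; rewrite eq_le measure_ge0 andbT.
apply/lee_addgt0Pr => e e0; rewrite add0e.
have [N _ /(_ N (leqnn N)) /= Ne] := near_infty_natSinv_lt (PosNum e0).
apply: (@le_trans _ _ (m (U N))).
  by apply: le_measure; rewrite ?inE// => x; exact.
by have [_ _ /le_trans] := hU N; apply; rewrite lee_fin ltW.
Qed.

End capacity_properties.

Theorem theorem3p11 (d : measure_display) (R : realType)
    (X : borelMetricType d R)
    (lcX : locally_compact [set: X]) (sepX : separable X)
    (m : {finite_measure set X -> \bar R})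
    (radon_m : radon m) (supp_m : full_support m)
    (D : set (X -> R)) (E : (X -> R) -> (X -> R) -> R)
    (E_dirichlet : dirichlet_form m D E)
    (E_regular : regular_form m D E)
    (E_local : strongly_local m D E)
    (Gamma : (X -> R) -> (X -> R) -> X -> R)
    (Gamma_cdc : carre_du_champ m D E Gamma)
    (E_coercive : coercive m D E)
    (p : R) (p_gt2 : 2 < p) :
  [/\ strongly_subadditive_on_compacts (cap m D Gamma p),
      choquet_capacity (cap m D Gamma p),
      (forall A_ : nat -> set X,
         (cap m D Gamma p (\bigcup_i A_ i)
            <= \sum_(0 <= i <oo) cap m D Gamma p (A_ i))%E) &
      (forall A : set X, cap m D Gamma p A = 0%E -> m.-negligible A)].

Proof.
have hX : hausdorff_space X by exact: metric_hausdorff.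
have nX : normal_space X by exact: pseudometric_normal.
have c_ge0 := @cap_compact_ge0 _ _ X m D Gamma p.
have le_c := @le_cap_compact _ _ X m D Gamma p.
have c_sub := cap_compact_strong_subadd lcX radon_m E_dirichlet E_regular E_local
  Gamma_cdc p_gt2.
split.
(* The outer capacity is strongly subadditive on arbitrary sets, in particular on compact ones. *)
- by move=> K L _ _; exact: (outer_cap_strong_subadd hX nX c_ge0 le_c c_sub).
- exact: (outer_cap_choquet hX nX c_ge0 le_c c_sub).
- exact: (outer_cap_sigma_subadd hX nX c_ge0 le_c c_sub).
- exact: (cap_eq0_negligible radon_m E_dirichlet E_local Gamma_cdc E_coercive p_gt2).
Qed.
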